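(* Let $0<p<1$. (a) Let $F\in H_p(G)$ and let $\{m_k:k\ge0\}$ be a sequence of positive integers such that $$\omega_{H_p}\!\left(\frac1{2^{|m_k|}},F\right)=o\!\left(\frac1{2^{d(m_k)(1/p-1)}}\right)\quad\text{as }k\to\infty .$$ Then $\|S_{m_k}F-F\|_{H_p}\to0$ as $k\to\infty$. (b) There is a constant $c_p>0$, depending only on $p$, such that the following holds. Let $\{m_k:k\ge0\}$ be any increasing sequence of positive integers with $\sup_{k\in\mathbb{N}}d(m_k)=\infty$. Then there exist a martingale $F\in H_p(G)$ and a subsequence $\{\alpha_k:k\ge0\}\subset\{m_k:k\ge0\}$ for which $$\omega_{H_p}\!\left(\frac1{2^{|\alpha_k|}},F\right)=O\!\left(\frac1{2^{d(\alpha_k)(1/p-1)}}\right)\quad\text{as }k\to\infty$$ and $$\limsup_{k\to\infty}\|S_{\alpha_k}F-F\|_{L_{p,\infty}}>c_p>0 .$$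
   Context: $\mathbb{N}_+$ is the set of positive integers and $\mathbb{N}=\mathbb{N}_+\cup\{0\}$. $G=\prod_{k=0}^\infty Z_2$ is the dyadic (Walsh) group, i.e. the set of sequences $x=(x_0,x_1,\dots)$, $x_k\in\{0,1\}$, with coordinatewise addition mod 2, product topology, and normalized Haar measure $\mu$ (the product of the measures giving mass $1/2$ to each point of $Z_2$). Put $I_0(x)=G$, $I_n(x)=\{y\in G: y_0=x_0,\dots,y_{n-1}=x_{n-1}\}$, and let $\zeta_n$ be the $\sigma$-algebra generated by $\{I_n(x):x\in G\}$. For $n\in\mathbb{N}_+$ with binary expansion $n=\sum_{j\ge0}n_j2^j$, $n_j\in\{0,1\}$, put $\langle n\rangle=\min\{j:n_j\ne0\}$, $|n|=\max\{j:n_j\neq0\}$, $d(n)=|n|-\langle n\rangle$. Rademacher functions: $r_k(x)=(-1)^{x_k}$. Walsh functions: $w_n(x)=\prod_{k\ge0}r_k(x)^{n_k}$, $n\in\mathbb{N}$. A martingale $F=(F_n,n\in\mathbb{N})$ is a martingale with respect to $(\zeta_n)_{n\in\mathbb N}$. Its maximal function is $F^*=\sup_n|F_n|$; for $0<p<\infty$, $H_p(G)$ is the space of martingales with $\|F\|_{H_p}:=\|F^*\|_p<\infty$, where $\|f\|_p^p=\int_G|f|^p\,d\mu$. Walsh–Fourier coefficients of a martingale: $\widehat F(k)=\lim_{n\to\infty}\int_GF_nw_k\,d\mu$ (the limit always exists). Partial sums: $S_nF=\sum_{k=0}^{n-1}\widehat F(k)w_k$; in particular $S_{2^n}F=F_n$.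 An integrable function $f$ (such as $S_nF$) is identified with the martingale $(E(f\mid\zeta_n))_{n}$ of its conditional expectations, so that $S_nF-F$ is a martingale. The modulus of continuity in $H_p(G)$, $0<p\le1$, is $\omega_{H_p}(1/2^n,F):=\|F-S_{2^n}F\|_{H_p}$. The weak quasi-norm is $\|f\|_{L_{p,\infty}}^p=\sup_{\lambda>0}\lambda^p\mu(|f|>\lambda)$. For a martingale in $H_p(G)$ (such as $S_nF-F$ with $F\in H_p(G)$), which converges a.e., the weak quasi-norm is taken of its a.e. limit function. *)

(* Defs.v *)
From HB Require Import structures.
From mathcomp Require Import all_boot all_order all_algebra.
From mathcomp Require Import all_classical all_reals all_analysis.
From mathcomp Require Import lra zify.

Set Implicit Arguments.
Unset Strict Implicit.
Unset Printing Implicit Defensive.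

Import Order.TTheory GRing.Theory Num.Theory.
Import numFieldNormedType.Exports.

Local Open Scope classical_set_scope.
Local Open Scope ring_scope.

Definition bit (n j : nat) : bool := odd (n %/ 2 ^ j).

(* For 0 < n every j with bit n j satisfies j < n, so the two definitions below
   are the largest and the smallest such j; both are 0 for n = 0. *)
Definition msb (n : nat) : nat := (\max_(j < n | bit n j) j)%N.

Definition lsb (n : nat) : nat := (\big[minn/n]_(j < n | bit n j) j)%N.

(* lsb n <= msb n, so the truncated subtraction is the true one. *)
Definition bitspan (n : nat) : nat := (msb n - lsb n)%N.

Definition dyadic_cylinder (n : nat) (x : nat -> bool) : set (nat -> bool) :=
  [set y | forall k, (k < n)%N -> y k = x k].

Definition cylinders_at (n : nat) : set (set (nat -> bool)) :=
  range (dyadic_cylinder n).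

Definition dyadic_cylinders : set (set (nat -> bool)) :=
  \bigcup_n cylinders_at n.

(* {0,1}^nat with the product sigma-algebra, which is the Borel sigma-algebra
   of the product topology since the cylinders are a countable base of it. *)
Notation walsh_group := (g_sigma_algebraType dyadic_cylinders).

Definition zeta (n : nat) : set (set walsh_group) := <<s cylinders_at n >>.

Section Haar_existence.
Variable R : realType.

Definition unit_itv : set R := `[0, 1[%classic.

Definition digit (x : R) (k : nat) : bool :=
  (x \in unit_itv) && odd (Num.truncn (2 ^+ k.+1 * x)).

Definition digits (x : measurableTypeR R) : walsh_group := digit x.

Fixpoint dyadic_num (n : nat) (y : nat -> bool) : nat :=
  if n is n'.+1 then (y n' + (dyadic_num n' y).*2)%N else 0%N.

Let dyadic_num_lt n y : (dyadic_num n y < 2 ^ n)%N.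
Proof. by elim: n => //= n IH; rewrite expnS; case: (y n) => /=; lia. Qed.

Let truncn_double (z : R) : 0 <= z -> (Num.truncn (2 * z))./2 = Num.truncn z.
Proof.
move=> z0; apply/esym/truncn_def.
have := truncn_itv (mulr_ge0 (ler0n R 2) z0).
set t := Num.truncn _ => /andP[t1 t2].
have te := odd_double_half t.
have tR : t%:R = (odd t)%:R + 2 * (t./2)%:R :> R.
  by rewrite -[in LHS]te natrD -mul2n natrM.
move: t2; rewrite -natr1 => t2; rewrite -natr1.
by apply/andP; move: tR t1 t2; case: (odd t) => /= tR t1 t2; split; lra.
Qed.

Let digits_cylinder n y (x : R) : 0 <= x < 1 ->
  (dyadic_cylinder n y (digits x)) <->
  ((dyadic_num n y)%:R <= 2 ^+ n * x < (dyadic_num n y).+1%:R).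
Proof.
move=> /[dup] x01 /andP[x0 x1].
have xn m : 0 <= 2 ^+ m * x by rewrite mulr_ge0// exprn_ge0.
rewrite -truncn_eq//.
elim: n => [|n IH].
  by split=> // _; rewrite expr0 mul1r truncn_eq// x0 x1.
have te := odd_double_half (Num.truncn (2 ^+ n.+1 * x)).
rewrite exprS -mulrA truncn_double// mulrA -exprS in te.
have dn : digits x n = odd (Num.truncn (2 ^+ n.+1 * x)).
  by rewrite /digits /digit /unit_itv mem_setE in_itv/= x01.
split=> [H|/eqP H].
  have /IH/eqP e : dyadic_cylinder n y (digits x).
    by move=> k kn; apply: H; rewrite ltnS ltnW.
  by rewrite -te -dn (H n)//= e.
have {}H : (odd (Num.truncn (2 ^+ n.+1 * x)) = y n) /\
    Num.truncn (2 ^+ n * x) = dyadic_num n y.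
  move: H; rewrite -te /= !oddD !odd_double.
  by case: (odd _); case: (y n) => /= H; split => //; lia.
move=> k; rewrite ltnS leq_eqVlt => /predU1P[->|kn]; first by rewrite dn H.1.
by apply: (IH.2 _ k kn); rewrite H.2.
Qed.

Let preimage_cylinder n y :
  unit_itv `&` (digits @^-1` dyadic_cylinder n y) =
  `[(dyadic_num n y)%:R / 2 ^+ n, (dyadic_num n y).+1%:R / 2 ^+ n[%classic.
Proof.
have p : 0 < 2 ^+ n :> R by rewrite exprn_gt0.
apply/seteqP; split => [x [/=]|x /=].
  rewrite /unit_itv/= !in_itv/= => x01 /(digits_cylinder _ _ x01).
  by rewrite mulrC -ler_pdivrMr// -ltr_pdivlMr.
rewrite in_itv/= => xI.
have x01 : 0 <= x < 1.
  case/andP: xI => xl xr; apply/andP; split.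
    by apply: le_trans xl; rewrite divr_ge0// ltW.
  apply: lt_le_trans xr _; rewrite ler_pdivrMr// mul1r -natrX ler_nat.
  exact: dyadic_num_lt.
split; first by rewrite /unit_itv/= in_itv/=.
by apply/(digits_cylinder _ _ x01); rewrite mulrC -ler_pdivrMr// -ltr_pdivlMr.
Qed.

Let measurable_digits : measurable_fun [set: measurableTypeR R] digits.
Proof.
apply: (@measurability _ _ (measurableTypeR R) walsh_group setT digits dyadic_cylinders) => //.
move=> _ [_ [n _ [y _ <-]] <-]; rewrite setTI.
rewrite -[X in measurable X](setUIDK _ unit_itv) setIC preimage_cylinder.
apply: measurableU; first exact: measurable_itv.
have [y0|y0] := pselect (forall k, (k < n)%N -> y k = false).
  rewrite (_ : _ `\` _ = ~` unit_itv).
    by apply: measurableC; exact: measurable_itv.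
  apply/seteqP; split=> [x []//|x xI]; split => // k kn.
  by rewrite y0// /digits /digit memNset.
rewrite (_ : _ `\` _ = set0); first exact: measurable0.
apply/seteqP; split=> // x [xy xI]; apply: y0 => k kn.
by rewrite -xy// /digits /digit memNset.
Qed.

Definition unit_measure : set (measurableTypeR R) -> \bar R :=
  mrestr (@lebesgue_measure R) (measurable_itv `[0, 1[).

HB.instance Definition _ := Measure.on unit_measure.

Let unit_measureT : unit_measure setT = 1%:E.
Proof.
by rewrite /unit_measure /mrestr setTI lebesgue_measure_itv/= lte_fin ltr01 sube0.
Qed.

HB.instance Definition _ :=
  Measure_isProbability.Build _ _ _ unit_measure unit_measureT.

HB.instance Definition _ := isMeasurableFun.Build _ _ _ _ digits measurable_digits.

Lemma haar_exists : exists mu : probability walsh_group R,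
  forall n x, mu (dyadic_cylinder n x) = (2 ^- n)%:E.
Proof.
exists (distribution unit_measure digits) => n x.
transitivity (unit_measure (digits @^-1` dyadic_cylinder n x)) => //.
rewrite /unit_measure /mrestr setIC preimage_cylinder lebesgue_measure_itv/=.
have p : 0 < 2 ^+ n :> R by rewrite exprn_gt0.
rewrite lte_fin ltr_pM2r ?invr_gt0// ltr_nat ltnSn -EFinD -mulrBl.
by rewrite -natrB// subSnn mul1r.
Qed.
End Haar_existence.

(* The normalized Haar measure: a probability measure on the product
   sigma-algebra is determined by its values on the pi-system of cylinders. *)
Definition haar (R : realType) : probability walsh_group R :=
  projT1 (cid (haar_exists R)).

Lemma haar_cylinder (R : realType) (n : nat) (x : walsh_group) :
  haar R (dyadic_cylinder n x) = (2 ^- n)%:E.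
Proof. exact: projT2 (cid (haar_exists R)) n x. Qed.

Section Martingales.
Variable R : realType.
Local Notation mu := (haar R).
Implicit Types (f g : walsh_group -> R) (F : nat -> walsh_group -> R).

Definition is_condexp (S : set (set walsh_group)) f g : Prop :=
  [/\ forall B : set R, measurable B -> S (g @^-1` B),
      mu.-integrable setT (EFin \o g) &
      forall A, S A ->
        (\int[mu]_(x in A) (g x)%:E = \int[mu]_(x in A) (f x)%:E)%E].

(* For S = zeta n every nonempty member of S has positive measure, so the
   version of the conditional expectation is unique. *)
Definition condexp (S : set (set walsh_group)) f : walsh_group -> R :=
  get (is_condexp S f).

Definition is_martingale F : Prop :=
  forall n, is_condexp (zeta n) (F n.+1) (F n).

Definition martingale_of f : nat -> walsh_group -> R :=
  fun n => condexp (zeta n) f.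

Definition rademacher (k : nat) (x : walsh_group) : R := (-1) ^+ x k.

Definition walsh (n : nat) (x : walsh_group) : R :=
  \prod_(k < n) rademacher k x ^+ bit n k.

Definition walsh_coef F (k : nat) : R :=
  limn (fun n => \int[mu]_x (F n x * walsh k x)).

Definition partial_sum (n : nat) F (x : walsh_group) : R :=
  \sum_(0 <= k < n) walsh_coef F k * walsh k x.

Definition maximal F (x : walsh_group) : \bar R :=
  ereal_sup (range (fun n => `|F n x|%:E)).

Definition Hp_norm (p : R) F : \bar R := Lnorm mu p%:E (maximal F).

Definition in_Hp (p : R) F : Prop :=
  is_martingale F /\ (Hp_norm p F < +oo)%E.

(* omega p n F is the modulus of continuity of F at 1 / 2 ^ n. *)
Definition omega (p : R) (n : nat) F : \bar R :=
  Hp_norm p (fun j x => F j x - martingale_of (partial_sum (2 ^ n) F) j x).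

Definition sum_error (m : nat) F : nat -> walsh_group -> R :=
  fun j x => martingale_of (partial_sum m F) j x - F j x.

Definition weak_norm (p : R) f : \bar R :=
  (ereal_sup [set ((l `^ p)%:E * mu [set x | (l < `|f x|)%R])%E
             | l in [set l : R | (0 < l)%R]] `^ p^-1)%E.

(* A martingale in H_p converges almost everywhere, so the default value of
   limn is taken on a null set only. *)
Definition martingale_limit F (x : walsh_group) : R := limn (F ^~ x).

(* Landau's o and O at infinity, for sequences u with values in \bar R. *)
Definition is_little_o (u : nat -> \bar R) (v : nat -> R) : Prop :=
  forall e : R, 0 < e -> \forall k \near \oo, (`|u k| <= (e * `|v k|)%:E)%E.

Definition is_big_O (u : nat -> \bar R) (v : nat -> R) : Prop :=
  exists C : R, \forall k \near \oo, (`|u k| <= (C * `|v k|)%:E)%E.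

End Martingales.

(* Main.v *)
(* Let [E_j] be the conditional expectation given [zeta j], [n = msb m],
   [l = lsb m], and let [a_j] be [m] with its binary digits of rank [<= j]
   cleared. Grouping the frequencies below [m] into dyadic blocks gives
     S_m F - F_n = sum of w_{a_j} E_j (w_{a_j} (F_{n+1} - F_n))
   over the [j] with [l <= j < n] and [bit m j]. Averaging out one coordinate
   costs a factor [2 ^ (1 - p)] in the integral of the p-th power, so that
     \int |S_m F - F_n|^p <= C_p 2^{(n - l) (1 - p)} \int |F_{n+1} - F_n|^p,
   and |F_{n+1} - F_n| is dominated by the maximal function of F - S_{2^n} F:
   this is (a).
   For (b), F_j is the sum over [t < j] of c_t r_t 1_{I_t(0)}, where [c_t] is
   nonzero only for [t = msb (alpha_k)], with d(alpha_k) > msb (alpha_{k-1}),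
   and then c_t^p = 2^t 2^{- d(alpha_k) (1 - p)}. On I_l(0) \ I_{l+1}(0), which
   has measure 2^{-l-1}, only the block [j = l] contributes to S_{alpha_k} F - F,
   whose absolute value there is the constant 2^{l/p}. *)

Require Import Defs.
From mathcomp Require Import all_boot all_order all_algebra.
From mathcomp Require Import all_classical all_reals all_analysis.
From mathcomp Require Import measurable_realfun ring lra zify.

Set Implicit Arguments.
Unset Strict Implicit.
Unset Printing Implicit Defensive.

Import Order.TTheory GRing.Theory Num.Theory.
Import numFieldNormedType.Exports.

Local Open Scope classical_set_scope.
Local Open Scope ring_scope.

(** * Binary digits *)

Lemma bit_ge n k : (n < 2 ^ k)%N -> bit n k = false.
Proof. by move=> nk; rewrite /bit divn_small. Qed.

Lemma bit_dvd a j i : (2 ^ j %| a)%N -> (i < j)%N -> bit a i = false.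
Proof.
move=> /dvdnP[c ->] ij; rewrite /bit -(subnK (ltnW ij)) expnD mulnA mulnK ?expn_gt0//.
by rewrite oddM oddX subn_eq0 leqNgt ij andbF.
Qed.

(** The digits of [a] below rank [j] and those of [k] from rank [j] on all vanish, so the addition
    produces no carry. *)
Lemma bitD a k j i : (2 ^ j %| a)%N -> (k < 2 ^ j)%N ->
  bit (a + k) i = (bit a i + bit k i)%N :> nat.
Proof.
move=> ja kj; have [ij|ji] := ltnP i j.
  rewrite (bit_dvd ja ij) /bit divnDl; last exact: dvdn_trans (dvdn_exp2l _ (ltnW ij)) ja.
  by rewrite oddD -/(bit a i) (bit_dvd ja ij).
rewrite [bit k i]bit_ge ?addn0; last by rewrite (leq_trans kj)// leq_exp2l.
have ij : (2 ^ i = 2 ^ j * 2 ^ (i - j))%N by rewrite -expnD subnKC.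
by rewrite /bit ij !divnMA divnDl// [(k %/ _)%N]divn_small// addn0.
Qed.

Lemma bit_exp2 j i : bit (2 ^ j) i = (i == j).
Proof.
have [ji|ij|->] := ltngtP j i.
- by rewrite bit_ge// ltn_exp2l.
- by rewrite (bit_dvd (dvdnn _) ij).
- by rewrite /bit divnn expn_gt0.
Qed.

(** Clears the digits of rank below [j]; the [a_j] of the overview is therefore
    [floor_exp2 m j.+1]. *)
Definition floor_exp2 m j := (m %/ 2 ^ j * 2 ^ j)%N.

Lemma floor_exp2S m j : floor_exp2 m j = (floor_exp2 m j.+1 + bit m j * 2 ^ j)%N.
Proof.
rewrite /floor_exp2 /bit {1}(divn_eq (m %/ 2 ^ j) 2) modn2 -divnMA mulnDl.
by rewrite -mulnA -!expnS expnSr.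
Qed.

Lemma floor_exp2_le m j : (floor_exp2 m j <= m)%N.
Proof. exact: leq_trunc_div. Qed.

Lemma divn_exp2_eq1 m k : (2 ^ k <= m < 2 ^ k.+1)%N -> (m %/ 2 ^ k = 1)%N.
Proof.
move=> /andP[km mk]; apply/eqP; rewrite eqn_leq leq_divRL ?expn_gt0// mul1n km.
by rewrite andbT -ltnS ltn_divLR ?expn_gt0// -expnS.
Qed.

Lemma msbP m : (0 < m)%N -> (2 ^ msb m <= m < 2 ^ (msb m).+1)%N.
Proof.
move=> m0; have /andP[km mk] := trunc_log_bounds (ltnSn 1) m0.
suff -> : msb m = trunc_log 2 m by rewrite km mk.
set k := trunc_log 2 m in km mk *.
have bk : bit m k by rewrite /bit divn_exp2_eq1// km mk.
have ltkm : (k < m)%N by rewrite (leq_trans _ km)// ltn_expl.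
apply/eqP; rewrite eqn_leq; apply/andP; split.
  apply/bigmax_leqP => j; apply: contraTT; rewrite -ltnNge => kj.
  by rewrite bit_ge// (leq_trans mk)// leq_exp2l.
by rewrite /msb (bigD1 (Ordinal ltkm))//= leq_maxl.
Qed.

(** [lsb m] is the 2-adic valuation [v] of [m]: the cofactor of [2 ^ v] is odd, which gives the
    digit at [v], and divisibility by [2 ^ v] kills all digits below. *)
Lemma lsbP m : (0 < m)%N -> (2 ^ lsb m %| m)%N /\ bit m (lsb m).
Proof.
move=> m0; pose v := logn 2 m.
have vm : (2 ^ v %| m)%N := pfactor_dvdnn 2 m.
have bv : bit m v.
  rewrite /bit; have [//|k k2 ->] := @pfactor_coprime 2 m _ m0.
  by rewrite mulnK ?expn_gt0//; rewrite coprime2n in k2.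
suff -> : lsb m = v by [].
have ltvm : (v < m)%N by rewrite (leq_trans _ (dvdn_leq m0 vm))// ltn_expl.
apply/eqP; rewrite eqn_leq; apply/andP; split.
  rewrite /lsb; have := mem_index_enum (Ordinal ltvm).
  elim: index_enum => // j s IH; rewrite inE big_cons => /predU1P[<-/=|/IH le].
    by rewrite bv geq_minl.
  by case: ifP => // _; rewrite (leq_trans _ le)// geq_minr.
apply: (big_ind (fun x => v <= x)%N) => [|x y vx vy|j]; first exact: ltnW.
  by rewrite leq_min vx.
by apply: contraTT; rewrite -ltnNge => /(bit_dvd vm) ->.
Qed.

Lemma leq_lsb_msb m : (0 < m)%N -> (lsb m <= msb m)%N.
Proof.
move=> m0; have [lm _] := lsbP m0; have /andP[_ mm] := msbP m0.
by rewrite -ltnS -(@ltn_exp2l 2)// (leq_ltn_trans _ mm)// dvdn_leq.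
Qed.

Lemma floor_exp2_dvd m j : (2 ^ j %| m)%N -> floor_exp2 m j = m.
Proof. exact: divnK. Qed.

Lemma floor_exp2_msb m : (0 < m)%N -> floor_exp2 m (msb m) = (2 ^ msb m)%N.
Proof.
by move=> /msbP m2; rewrite /floor_exp2 divn_exp2_eq1// mul1n.
Qed.

(** Clearing digits of rank below [j <= n] leaves every digit from rank [n] on untouched. *)
Lemma floor_exp2_ge m n j : (2 ^ n <= m)%N -> (j <= n)%N -> (2 ^ n <= floor_exp2 m j)%N.
Proof.
move=> nm jn; rewrite /floor_exp2 -{1}(subnK jn) expnD leq_mul2r.
by rewrite leq_divRL ?expn_gt0// -expnD subnK// nm orbT.
Qed.

(** * Cylindrical functions and their conditional expectations *)

Section cylindrical.
Variable T : Type.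
Implicit Types (f g : walsh_group -> T).

(** For real functions this is measurability with respect to [zeta n], a sigma-algebra with finitely
    many atoms. The pointwise form makes boundedness, measurability and integrability automatic and
    applies to sets as well ([T := Prop]). *)
Definition cylindrical n f :=
  forall x y : walsh_group, dyadic_cylinder n x y -> f y = f x.

Lemma cylindrical_le m n f : cylindrical m f -> (m <= n)%N -> cylindrical n f.
Proof. by move=> cf mn x y xy; apply: cf => k km; rewrite xy// (leq_trans km). Qed.

(** Padding with [false] selects one point in each of the [2 ^ n] cylinders of level [n]. *)
Definition of_tuple n (t : n.-tuple bool) : walsh_group := nth false t.

Lemma of_tupleP n x : exists t : n.-tuple bool, dyadic_cylinder n x (of_tuple t).
Proof.
exists [tuple x (val i) | i < n] => k kn.
by rewrite /of_tuple -[k]/(val (Ordinal kn)) -tnth_nth tnth_mktuple.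
Qed.

End cylindrical.

Lemma cylindrical_comp (T U : Type) (h : T -> U) n f :
  cylindrical n f -> cylindrical n (h \o f).
Proof. by move=> cf x y xy /=; rewrite (cf _ _ xy). Qed.

Lemma cylindrical_comp2 (T U V : Type) (h : T -> U -> V) n f g :
  cylindrical n f -> cylindrical n g -> cylindrical n (fun x => h (f x) (g x)).
Proof. by move=> cf cg x y xy /=; rewrite (cf _ _ xy) (cg _ _ xy). Qed.

Lemma cylindrical_sum (R : nmodType) (J : Type) (s : seq J) (P : pred J) n
    (f : J -> walsh_group -> R) :
  (forall j, P j -> cylindrical n (f j)) ->
  cylindrical n (fun x => \sum_(j <- s | P j) f j x).
Proof. by move=> cf x y xy; apply: eq_bigr => j Pj; apply: cf. Qed.

Lemma cylinder_sym n x y : dyadic_cylinder n x y -> dyadic_cylinder n y x.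
Proof. by move=> xy k kn; rewrite xy. Qed.

Lemma cylinder_trans n x y z :
  dyadic_cylinder n x y -> dyadic_cylinder n y z -> dyadic_cylinder n x z.
Proof. by move=> xy yz k kn; rewrite yz// xy. Qed.

Lemma cylinder_eq n x y :
  dyadic_cylinder n x y -> dyadic_cylinder n y = dyadic_cylinder n x.
Proof.
move=> xy; apply/seteqP; split=> z; first exact: cylinder_trans.
by apply: cylinder_trans; exact: cylinder_sym.
Qed.

Lemma zeta_cylinder n x : zeta n (dyadic_cylinder n x).
Proof. by apply: sub_sigma_algebra; exists x. Qed.

(** The sets that are unions of cylinders of level [n] form a sigma-algebra containing these
    cylinders; conversely such a union is finite, being indexed by [n]-tuples of bits. *)
Lemma zetaE n (A : set walsh_group) : zeta n A <-> cylindrical n A.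
Proof.
split=> [|cA].
  apply: smallest_sub => //; last first.
    by move=> _ [z _ <-] x y xy; apply/propext; split;
      [move/cylinder_trans; apply; apply: cylinder_sym|move/cylinder_trans; apply].
  split=> [x y|B cB x y xy|B cB x y xy]; first by [].
    by rewrite !setTD; apply/propext; rewrite /setC/= (cB _ _ xy).
  by apply/propext; split=> -[i _ Bi]; exists i => //; rewrite (cB i _ _ xy) in Bi *.
rewrite (_ : A = \bigcup_(t in [set t : n.-tuple bool | A (of_tuple t)])
    dyadic_cylinder n (of_tuple t)).
  apply: (@fin_bigcup_measurable _ (g_sigma_algebraType (cylinders_at n))).
    exact: finite_finset.
  by move=> t _; exact: zeta_cylinder.
apply/seteqP; split=> [x Ax|x [t At tx]]; last by rewrite (cA _ _ tx).
have [t xt] := of_tupleP n x; exists t; last exact: cylinder_sym.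
by rewrite /= (cA _ _ xt).
Qed.

Lemma zeta_measurable n (A : set walsh_group) : zeta n A -> measurable A.
Proof.
apply: smallest_sub; first exact: smallest_sigma_algebra.
by move=> B Bn; apply: sub_sigma_algebra; exists n.
Qed.

Lemma measurable_cylinder n x : @measurable _ walsh_group (dyadic_cylinder n x).
Proof. exact: zeta_measurable (@zeta_cylinder n x). Qed.

(** Conditional expectations of a cylindrical function are trivial at high levels, and going from
    level [n.+1] to [n] averages one coordinate; this scheme matches that descent. *)
Lemma downward_ind (N m : nat) (P : nat -> Prop) :
  (forall n, (N <= n)%N -> P n) -> (forall n, (m <= n)%N -> P n.+1 -> P n) ->
  forall n, (m <= n)%N -> P n.
Proof.
move=> PN PS n mn; have [k] := ubnP (N - n); elim: k => // k IH in n mn *.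
have [/PN//|nN Nnk] := leqP N n.
by apply: PS => //; apply: IH; lia.
Qed.

Section cylindrical_integral.
Variable R : realType.
Local Notation mu := (haar R).
Implicit Types (f g : walsh_group -> R).

Lemma cylindrical_measurable n f : cylindrical n f -> measurable_fun setT f.
Proof.
move=> cf _ B mB; rewrite setTI; apply: (@zeta_measurable n). apply/zetaE.
exact: (cylindrical_comp B cf).
Qed.

Lemma cylindrical_bounded n f : cylindrical n f -> exists M, forall x, `|f x| <= M.
Proof.
move=> cf; exists (\sum_(t : n.-tuple bool) `|f (of_tuple t)|) => x.
have [t xt] := of_tupleP n x; rewrite -(cf _ _ xt) (bigD1 t)//= lerDl.
by apply: sumr_ge0.
Qed.

Lemma cylindrical_integrable n f A : cylindrical n f -> measurable A ->
  mu.-integrable A (EFin \o f).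
Proof.
move=> cf mA; apply: (@integrableS _ _ _ _ setT) => //.
apply: measurable_bounded_integrable => //; first exact: fin_num_fun_lty.
  exact: cylindrical_measurable cf.
have [M Mf] := cylindrical_bounded cf.
exists M; split; first by rewrite num_real.
by move=> N MN x _; rewrite /= (le_trans (Mf x))// ltW.
Qed.

(** The conditional expectation given [zeta n] as an explicit mean, each cylinder of level [n]
    having mass [2 ^- n]. *)
Definition cexp n f (x : walsh_group) : R :=
  2 ^+ n * \int[mu]_(y in dyadic_cylinder n x) f y.

Lemma cylindrical_cexp n f : cylindrical n (cexp n f).
Proof. by move=> x y xy; rewrite /cexp (cylinder_eq xy). Qed.

Lemma cexp_id n f : cylindrical n f -> cexp n f = f.
Proof.
move=> cf; apply/funext => x; rewrite /cexp.
rewrite (@eq_Rintegral _ _ _ _ _ (cst (f x))); last first.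
  by move=> y; rewrite inE => xy; rewrite (cf _ _ xy).
rewrite Rintegral_cst; last exact: measurable_cylinder.
by rewrite [X in fine X]haar_cylinder/= mulrCA divff ?mulr1// expf_neq0.
Qed.

Definition update (x : walsh_group) k b : walsh_group :=
  fun i => if i == k then b else x i.

(** On functions of level [k.+1] this is the conditional expectation given [zeta k], by
    [cexp_step]. *)
Definition average k f x := (f (update x k false) + f (update x k true)) / 2.

Lemma cylinder_split n x : dyadic_cylinder n x =
  dyadic_cylinder n.+1 (update x n false) `|` dyadic_cylinder n.+1 (update x n true).
Proof.
apply/seteqP; split=> [y xy|y xy k kn]; last first.
  by case: xy => /(_ k (ltnW kn)) ->; rewrite /update ltn_eqF.
case yn : (y n); [right|left] => k; rewrite ltnS leq_eqVlt /update;
  by case: eqP => [->//|_ /= kn]; rewrite xy.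
Qed.

(** A cylinder of level [n] is the disjoint union of two of level [n.+1], with half the mass
    each. *)
Lemma cexp_step N n f : cylindrical N f -> cexp n f = average n (cexp n.+1 f).
Proof.
move=> cf; apply/funext => x; rewrite /average /cexp cylinder_split.
rewrite Rintegral_setU; first by rewrite exprS; field.
- exact: measurable_cylinder.
- exact: measurable_cylinder.
- apply: cylindrical_integrable cf _.
  by apply: measurableU; exact: measurable_cylinder.
apply/disj_setPS => y [/(_ n (ltnSn n)) + /(_ n (ltnSn n))].
by rewrite /update eqxx => ->.
Qed.

End cylindrical_integral.

Section cexp_calculus.
Variable R : realType.
Local Notation mu := (haar R).
Implicit Types (f g u : walsh_group -> R).

Lemma cylindricalM m n u f : cylindrical m u -> cylindrical n f ->
  cylindrical (maxn m n) (u \* f).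
Proof.
move=> cu cf; apply: cylindrical_comp2.
  exact: cylindrical_le cu (leq_maxl _ _).
exact: cylindrical_le cf (leq_maxr _ _).
Qed.

Lemma average_mull n u f : cylindrical n u -> average n (u \* f) = u \* average n f.
Proof.
move=> cu; apply/funext => x; rewrite /average /=.
have updP b : dyadic_cylinder n x (update x n b).
  by move=> k; rewrite /update; case: ltngtP.
by rewrite !(cu _ _ (updP _)) -mulrDr mulrA.
Qed.

Lemma average_id n u : cylindrical n u -> average n u = u.
Proof.
move=> cu; have := average_mull (cst 1) cu.
rewrite /average; set c := (X in _ = u \* X).
have -> : c = cst 1 by apply/funext => x; rewrite /c /cst; field.
by move=> /funeqP h; apply/funext => x; have := h x; rewrite /= !mulr1.
Qed.

Lemma cexp_mull N m n u f : cylindrical N f -> cylindrical m u -> (m <= n)%N ->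
  cexp n (u \* f) = u \* cexp n f.
Proof.
move=> cf cu; move: n; apply: (@downward_ind (maxn m N)) => n.
  rewrite geq_max => /andP[mn Nn].
  have [cnf cnu] := (cylindrical_le cf Nn, cylindrical_le cu mn).
  by rewrite !cexp_id//; exact: cylindrical_comp2.
move=> mn IH; have cuf := cylindricalM cu cf.
rewrite (cexp_step n cuf) (cexp_step n cf) IH average_mull//.
exact: (cylindrical_le cu).
Qed.

Lemma cexp_tower N m n f : cylindrical N f -> (m <= n)%N ->
  cexp m (cexp n f) = cexp m f.
Proof.
move=> cf; move: (leq0n m); move: m; apply: (@downward_ind n) => m.
  move=> nm mn; have -> : m = n by lia.
  by rewrite cexp_id//; exact: cylindrical_cexp.
move=> _ IH mn; rewrite (cexp_step m cf) (cexp_step m (@cylindrical_cexp _ n f)).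
have [e|ltmn] := eqVneq m n; last by rewrite IH// ltn_neqAle ltmn.
have cnf := @cylindrical_cexp _ n f.
by rewrite e (cexp_id (cylindrical_le cnf (leqnSn n))) -(cexp_step n cf) average_id.
Qed.

Lemma cexpD N n f g : cylindrical N f -> cylindrical N g ->
  cexp n (f \+ g) = cexp n f \+ cexp n g.
Proof.
move=> cf cg; apply/funext => x; rewrite /cexp /= RintegralD ?mulrDr//.
- exact: measurable_cylinder.
- exact: cylindrical_integrable cf (measurable_cylinder _ _).
- exact: cylindrical_integrable cg (measurable_cylinder _ _).
Qed.

Lemma cexp_sum N n (J : Type) (s : seq J) (P : pred J) (f : J -> walsh_group -> R) x :
  (forall j, P j -> cylindrical N (f j)) ->
  cexp n (fun y => \sum_(j <- s | P j) f j y) x = \sum_(j <- s | P j) cexp n (f j) x.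
Proof.
move=> cf; elim: s => [|j s IH].
  rewrite big_nil; under eq_fun do rewrite big_nil.
  by rewrite cexp_id.
rewrite big_cons; under eq_fun do rewrite big_cons.
case: ifP => // Pj; rewrite -IH.
have := cexpD n (cf j Pj) (@cylindrical_sum R J s P N f cf).
by rewrite /GRing.add_fun/= => ->.
Qed.

Lemma cexp_ge0 n f x : (forall y, 0 <= f y) -> 0 <= cexp n f x.
Proof. by move=> f0; rewrite mulr_ge0 ?exprn_ge0// Rintegral_ge0. Qed.

Lemma le_cexp N n f g x : cylindrical N f -> cylindrical N g ->
  (forall y, f y <= g y) -> cexp n f x <= cexp n g x.
Proof.
move=> cf cg fg; rewrite ler_wpM2l ?exprn_ge0// le_Rintegral//.
- exact: measurable_cylinder.
- exact: cylindrical_integrable cf (measurable_cylinder _ _).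
- exact: cylindrical_integrable cg (measurable_cylinder _ _).
Qed.

Lemma norm_cexp N n f x : cylindrical N f ->
  `|cexp n f x| <= cexp n (fun y => `|f y|) x.
Proof.
move=> cf; rewrite normrM ger0_norm ?exprn_ge0// ler_wpM2l ?exprn_ge0//.
apply: le_normr_Rintegral; first exact: measurable_cylinder.
exact: cylindrical_integrable cf (measurable_cylinder _ _).
Qed.

Lemma cexp0E f x : cexp 0 f x = \int[mu]_y f y.
Proof.
rewrite /cexp mul1r; congr (Rintegral _ _ _).
by apply/seteqP; split.
Qed.

Lemma cylindrical_rademacher k : cylindrical k.+1 (@rademacher R k).
Proof. by move=> x y xy; rewrite /rademacher xy. Qed.

Lemma rademacher_sqr k x : rademacher R k x * rademacher R k x = 1.
Proof. by rewrite /rademacher -expr2 sqrr_sign. Qed.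

Lemma cexp_rademacher n : cexp n (@rademacher R n) = cst 0.
Proof.
have cr := @cylindrical_rademacher n.
rewrite (cexp_step n cr) (cexp_id cr); apply/funext => x.
by rewrite /average /rademacher /update eqxx expr0 expr1 subrr mul0r.
Qed.

End cexp_calculus.

(** * Walsh functions and dyadic blocks of Walsh series *)

Section walsh_functions.
Variable R : realType.
Implicit Types (f g u : walsh_group -> R).
Local Notation w := (@walsh R).
Local Notation rad := (@rademacher R).

Lemma walsh_wide N n x : (n <= N)%N -> w n x = \prod_(k < N) rad k x ^+ bit n k.
Proof.
move=> nN; rewrite /walsh -!(big_mkord xpredT (fun k => rad k x ^+ bit n k)).
rewrite [RHS](@big_cat_nat _ _ _ n)//= [X in _ * X]big1_seq ?mulr1//.
move=> k /=; rewrite mem_index_iota => /andP[nk _].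
by rewrite bit_ge// (leq_ltn_trans nk)// ltn_expl.
Qed.

Lemma cylindrical_walsh j n : (n < 2 ^ j)%N -> cylindrical j (w n).
Proof.
move=> nj x y xy; apply: eq_bigr => k _.
have [kj|jk] := ltnP k j; first by rewrite /rademacher xy.
by rewrite bit_ge// (leq_trans nj)// leq_exp2l.
Qed.

Lemma walsh_add j a k : (2 ^ j %| a)%N -> (k < 2 ^ j)%N ->
  w (a + k) = w a \* w k.
Proof.
move=> ja kj; apply/funext => x /=.
rewrite (@walsh_wide (a + k) a)  ?leq_addr// (@walsh_wide (a + k) k) ?leq_addl//.
by rewrite -big_split; apply: eq_bigr => i _ /=; rewrite -exprD (bitD _ ja).
Qed.

Lemma walsh_exp2 j : w (2 ^ j) = rad j.
Proof.
apply/funext => x; have j2 : (j < 2 ^ j)%N by rewrite ltn_expl.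
rewrite /walsh (bigD1 (Ordinal j2))//= big1 ?mulr1 ?bit_exp2 ?eqxx//.
by move=> k; rewrite -val_eqE /= bit_exp2 => /negbTE ->.
Qed.

Lemma walsh0 : w 0 = cst 1.
Proof. by apply/funext => x; rewrite /walsh big_ord0. Qed.

Lemma norm_walsh n x : `|w n x| = 1.
Proof.
rewrite normr_prod big1// => k _.
by rewrite normrX /rademacher normr_sign expr1n.
Qed.

(** On a cylinder of level [n] the first term is the mean of the values on the two halves and the
    second is half their difference, signed by the half containing the point. *)
Lemma cexp_rademacher_step N n f : cylindrical N f ->
  cexp n f \+ rad n \* cexp n (rad n \* f) = cexp n.+1 f.
Proof.
move=> cf; have cr := @cylindrical_rademacher R n.
have crf := cylindricalM cr cf.
rewrite (cexp_step n cf) (cexp_step n crf) (cexp_mull cf cr (leqnn _)).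
apply/funext => x; have := @cylindrical_cexp _ n.+1 f; set g := cexp _ _ => cg.
have upd b : x n = b -> g (update x n b) = g x.
  move=> xb; apply: cg => k; rewrite /update ltnS leq_eqVlt.
  by case: eqP => [->|].
rewrite /= /average /= /rademacher /update eqxx /=.
rewrite -!/(update _ _ _).
have [xn|xn] := boolP (x n); rewrite ?expr0 ?expr1.
  by rewrite (upd true)//; field.
by rewrite (upd false) ?(negbTE xn)//; field.
Qed.

(** This is [S_{2^j} f = E_j f]. By induction: the frequencies from [2 ^ j] to [2 ^ j.+1] are those
    below [2 ^ j] multiplied by [rad j], so they contribute [rad j] times the sum for
    [rad j \* f]. *)
Lemma walsh_sum N j f x : cylindrical N f ->
  \sum_(0 <= k < 2 ^ j) cexp 0 (w k \* f) x * w k x = cexp j f x.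
Proof.
elim: j N f => [|j IH] N f cf.
  rewrite expn0 big_nat1 walsh0 mulr1; congr (cexp 0 _ x).
  by apply/funext => y /=; rewrite mul1r.
have crf := cylindricalM (@cylindrical_rademacher R j) cf.
rewrite -(cexp_rademacher_step j cf) /= -(IH _ _ cf) -(IH _ _ crf).
have e : (2 ^ j.+1 = 2 ^ j + 2 ^ j)%N by rewrite expnS mul2n addnn.
rewrite e (@big_cat_nat _ _ _ (2 ^ j)%N) ?leq_addr//=; congr (_ + _).
rewrite -{1}[(2 ^ j)%N]add0n big_addn addnK big_distrr /=.
apply: eq_big_nat => k /andP[_ kj].
rewrite addnC (@walsh_add j)// walsh_exp2 /= mulrCA; congr (_ * (_ * _)).
by congr (cexp 0 _ x); apply/funext => y /=; rewrite [RHS]mulrCA mulrA.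
Qed.

(** Multiplying by [w a] translates the block of frequencies starting at [a] to the block starting
    at 0, where [walsh_sum] applies. *)
Lemma walsh_block N j a f x : cylindrical N f -> (2 ^ j %| a)%N ->
  \sum_(a <= k < a + 2 ^ j) cexp 0 (w k \* f) x * w k x = w a x * cexp j (w a \* f) x.
Proof.
move=> cf ja.
have cwf := cylindricalM (cylindrical_walsh (ltn_expl a (ltnSn 1))) cf.
rewrite -(walsh_sum j x cwf) -{1}[a]add0n big_addn addKn big_distrr /=.
apply: eq_big_nat => k /andP[_ kj].
rewrite addnC (@walsh_add j)//= mulrCA; congr (_ * (_ * _)).
by congr (cexp 0 _ x); apply/funext => y /=; rewrite [RHS]mulrCA mulrA.
Qed.

End walsh_functions.

(** * Dyadic martingales and their partial sums *)

Section martingales.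
Variable R : realType.
Local Notation mu := (haar R).
Implicit Types (f g u : walsh_group -> R) (F : nat -> walsh_group -> R).
Local Notation w := (@walsh R).
Local Notation rad := (@rademacher R).

Lemma integral_cylindrical N f (A : set walsh_group) : cylindrical N f ->
  measurable A -> (\int[mu]_(x in A) (f x)%:E = (\int[mu]_(x in A) f x)%:E)%E.
Proof.
move=> cf mA; rewrite /Rintegral fineK//.
exact: integrable_fin_num (cylindrical_integrable cf mA).
Qed.

Lemma Rintegral_cexp N n f : cylindrical N f ->
  \int[mu]_x cexp n f x = \int[mu]_x f x.
Proof. by move=> cf; rewrite -!(cexp0E _ point) (cexp_tower cf). Qed.

(** For [A] in [zeta n] the indicator of [A] has level [n], so it passes through [cexp n], which
    preserves the integral. *)
Lemma is_condexp_cexp N n f : cylindrical N f -> is_condexp (zeta n) f (cexp n f).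
Proof.
move=> cf; have cg := @cylindrical_cexp _ n f; split=> [B _||A zA].
- by apply/zetaE; exact: (cylindrical_comp B cg).
- exact: cylindrical_integrable cg measurableT.
have mA := zeta_measurable zA; have /zetaE cA := zA.
rewrite (integral_cylindrical cf)// (integral_cylindrical cg)//.
rewrite (Rintegral_mkcond _ A f) Rintegral_mkcond; congr EFin.
have restrE h : h \_ A = (\1_A : walsh_group -> R) \* h.
  by apply/funext => x; rewrite /patch /= indicE; case: ifP; rewrite ?mul1r ?mul0r.
have c1 : cylindrical n (\1_A : walsh_group -> R).
  by move=> x y xy; rewrite !indicE; congr ((nat_of_bool _)%:R);
    apply/idP/idP; rewrite !inE (cA _ _ xy).
by rewrite !restrE -(cexp_mull cf c1 (leqnn n)) (Rintegral_cexp n (cylindricalM c1 cf)).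
Qed.

Lemma cylindrical_is_condexp n f g : is_condexp (zeta n) f g -> cylindrical n g.
Proof.
case=> mg _ _ x y xy; have /zetaE cg := mg [set g x] (measurable_set1 _).
by have : (g @^-1` [set g x]) y by rewrite (cg _ _ xy).
Qed.

(** No exceptional null set arises: [g] is constant on each cylinder of level [n], so its value
    there is read off from the integral over that cylinder. *)
Lemma is_condexp_uniq N n f g : cylindrical N f ->
  is_condexp (zeta n) f g -> g = cexp n f.
Proof.
move=> cf fg; have cg := cylindrical_is_condexp fg; rewrite -(cexp_id cg).
apply/funext => x; rewrite /cexp /Rintegral; congr (_ * fine _).
by case: fg => _ _; apply; exact: zeta_cylinder.
Qed.

Lemma condexpE N n f : cylindrical N f -> condexp (zeta n) f = cexp n f.
Proof.
move=> cf; apply: (is_condexp_uniq cf); apply: getPex.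
by exists (cexp n f); exact: is_condexp_cexp cf.
Qed.

Lemma walsh_top n a : (2 ^ n <= a < 2 ^ n.+1)%N ->
  exists2 b, (b < 2 ^ n)%N & w a = w b \* rad n.
Proof.
move=> /andP[na an]; have bn : (a - 2 ^ n < 2 ^ n)%N.
  by rewrite ltn_subLR// addnn -mul2n -expnS.
exists (a - 2 ^ n)%N => //; rewrite -{1}(subnKC na) (walsh_add R (dvdnn _) bn).
by rewrite walsh_exp2; apply/funext => x; rewrite /= mulrC.
Qed.

Lemma cexp_walsh n a : (2 ^ n <= a < 2 ^ n.+1)%N -> cexp n (w a) = cst 0.
Proof.
move=> /walsh_top[b bn ->].
rewrite (cexp_mull (@cylindrical_rademacher R n) (@cylindrical_walsh R n b bn) (leqnn n)).
by rewrite cexp_rademacher; apply/funext => x; rewrite /= mulr0.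
Qed.

Section martingale_theory.
Variable F : nat -> walsh_group -> R.

(** Turns the integral definition into identities valid at every point, so that martingales are
    handled by the algebra of [cexp]. *)
Lemma is_martingaleP :
  is_martingale F <-> forall n, cylindrical n (F n) /\ cexp n (F n.+1) = F n.
Proof.
split=> [mF n|mF n]; last first.
  by rewrite -(mF n).2; apply: is_condexp_cexp (mF n.+1).1.
split; first exact: cylindrical_is_condexp (mF n).
exact/esym/(is_condexp_uniq (cylindrical_is_condexp (mF n.+1)) (mF n)).
Qed.

Hypothesis mF : is_martingale F.

Lemma cylindrical_martingale n : cylindrical n (F n).
Proof. exact: (is_martingaleP.1 mF n).1. Qed.
Let cF := cylindrical_martingale.

Lemma cexp_martingale m n : (m <= n)%N -> cexp m (F n) = F m.
Proof.
elim: n => [|n IH]; first by rewrite leqn0 => /eqP ->; exact: cexp_id.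
rewrite leq_eqVlt => /predU1P[->|mn]; first exact: cexp_id.
rewrite -(cexp_tower (@cF n.+1) (mn : (m <= n)%N)).
by rewrite (is_martingaleP.1 mF n).2 IH.
Qed.

(** The sequence in the limit is constant from rank [N] on, because [w k] has level [N] and [F n]
    averages to [F N]. Since [cexp 0] is a constant function, the point [x] is arbitrary. *)
Lemma walsh_coefE k N x : (k < 2 ^ N)%N -> walsh_coef F k = cexp 0 (w k \* F N) x.
Proof.
move=> kN; apply: lim_near_cst => //; exists N => // n /= Nn.
have cw := @cylindrical_walsh R N k kN.
rewrite -(cexp_martingale Nn) -(cexp_mull (@cF n) cw (leqnn N)).
rewrite (cexp_tower (cylindricalM cw (@cF n)))// cexp0E.
by apply: eq_Rintegral => y _; rewrite mulrC.
Qed.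

Lemma partial_sumE m N x : (m <= 2 ^ N)%N ->
  partial_sum m F x = \sum_(0 <= k < m) cexp 0 (w k \* F N) x * w k x.
Proof.
move=> mN; apply: eq_big_nat => k /andP[_ km].
by rewrite (walsh_coefE (N := N) x)// (leq_trans km).
Qed.

Lemma partial_sum_exp2 N : partial_sum (2 ^ N) F = F N.
Proof.
apply/funext => x; rewrite (@partial_sumE _ N)// (walsh_sum N x (@cF N)).
by rewrite cexp_id.
Qed.

Lemma cylindrical_partial_sum m N : (m <= 2 ^ N)%N ->
  cylindrical N (partial_sum m F).
Proof.
move=> mN x y xy; apply: eq_big_nat => k /andP[_ km].
by rewrite (@cylindrical_walsh R N k (leq_trans km mN) _ _ xy).
Qed.

(** Restoring the digit of rank [j], when it is 1, adds the block of [2 ^ j] frequencies starting at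
    [floor_exp2 m j.+1]; [walsh_block] evaluates it. *)
Lemma partial_sum_floor m N l d x : (m <= 2 ^ N)%N ->
  partial_sum (floor_exp2 m l) F x = partial_sum (floor_exp2 m (l + d)) F x +
  \sum_(l <= j < l + d | bit m j) w (floor_exp2 m j.+1) x *
    cexp j (w (floor_exp2 m j.+1) \* F N) x.
Proof.
move=> mN; elim: d => [|d IH]; first by rewrite addn0 big_geq ?addr0.
rewrite IH addnS big_mkcond [in RHS]big_mkcond big_nat_recr ?leq_addr//=.
rewrite [in RHS]addrCA addrC; congr (_ + _); rewrite floor_exp2S.
have le1 := leq_trans (floor_exp2_le m (l + d)) mN.
have le2 := leq_trans (floor_exp2_le m (l + d).+1) mN.
have := floor_exp2S m (l + d).
case: (bit _ _); last by rewrite mul0n !addn0 addr0.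
rewrite mul1n => e; rewrite e in le1; rewrite (partial_sumE x le1) (partial_sumE x le2).
rewrite (@big_cat_nat _ _ _ (floor_exp2 m (l + d).+1)) ?leq_addr//=.
rewrite (walsh_block x (@cF N))// /floor_exp2.
by rewrite dvdn_mull// dvdn_exp2l.
Qed.

(** The factor [F n] comes out of [E_n], and [E_n (w a) = 0] because [w a] contains [rad n]; then
    the tower property descends to [j]. *)
Lemma cexp_walsh_high n a j : (2 ^ n <= a < 2 ^ n.+1)%N -> (j <= n)%N ->
  cexp j (w a \* F n) = cst 0.
Proof.
move=> an jn; have cwa : cylindrical n.+1 (w a).
  by apply: cylindrical_walsh; case/andP: an.
rewrite (_ : w a \* F n = F n \* w a); last by apply/funext => x; rewrite /= mulrC.
rewrite -(cexp_tower (cylindricalM (@cF n) cwa) jn) (cexp_mull cwa (@cF n) (leqnn n)).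
rewrite cexp_walsh// (_ : _ \* _ = cst 0) ?cexp_id//.
by apply/funext => x; rewrite /= mulr0.
Qed.

End martingale_theory.

End martingales.

(** * Partial sums in L_p *)

Section Lp_estimates.
Variables (R : realType) (p : R).
Hypothesis p01 : 0 < p < 1.
Implicit Types (f g u : walsh_group -> R) (F : nat -> walsh_group -> R).
Local Notation w := (@walsh R).

Let p0 : 0 < p. Proof. by case/andP: p01. Qed.
Let p1 : p <= 1. Proof. by case/andP: p01 => _ /ltW. Qed.

(** For a fraction [s] in [[0, 1]] one has [s <= s ^ p]; apply this to the shares of [a] and [b] in
    [a + b] and add. *)
Lemma powR_addr_le (a b : R) : 0 <= a -> 0 <= b -> (a + b) `^ p <= a `^ p + b `^ p.
Proof.
move=> a0 b0; have [s0|] := ltP 0 (a + b); last first.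
  move=> s0; have /eqP -> : a + b == 0 by rewrite eq_le s0 addr_ge0.
  by rewrite powR0 ?gt_eqF// addr_ge0 ?powR_ge0.
have part c d : 0 <= c -> 0 <= d -> c + d = a + b ->
    c / (a + b) * (a + b) `^ p <= c `^ p.
  move=> c0 d0 e; have [->|cn0] := eqVneq c 0; first by rewrite !mul0r powR_ge0.
  have cs0 : 0 < c / (a + b) by rewrite divr_gt0// lt_neqAle eq_sym cn0.
  have -> : c `^ p = (c / (a + b)) `^ p * (a + b) `^ p.
    by rewrite -powRM ?(ltW s0) ?(ltW cs0)// divfK// gt_eqF.
  rewrite ler_wpM2r ?powR_ge0// ger1_powR// cs0/= ler_pdivrMr// mul1r -e lerDl//.
have -> : (a + b) `^ p = a / (a + b) * (a + b) `^ p + b / (a + b) * (a + b) `^ p.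
  by rewrite -mulrDl -mulrDl divff ?mul1r// gt_eqF.
by apply: lerD; [exact: part b0 _|apply: (part b a) => //; rewrite addrC].
Qed.

Lemma powR_sum_le (J : Type) (s : seq J) (P : pred J) (F : J -> R) :
  (forall j, P j -> 0 <= F j) ->
  (\sum_(j <- s | P j) F j) `^ p <= \sum_(j <- s | P j) F j `^ p.
Proof.
move=> F0; elim: s => [|j s IH]; first by rewrite !big_nil powR0 ?gt_eqF.
rewrite !big_cons; case: ifP => // Pj.
apply: le_trans (powR_addr_le (F0 j Pj) _) _; first exact: sumr_ge0.
by rewrite lerD2l.
Qed.

(* The factor lost in [L_p] when one coordinate is averaged out. *)
Definition loss : R := 2 `^ (1 - p).

Lemma loss_gt1 : 1 < loss.
Proof.
rewrite /loss -[ltLHS](powRr0 2) /powR; case: eqP => [/eqP|_]; first by rewrite pnatr_eq0.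
by rewrite ltr_expR ltr_pM2r ?ln_gt0 ?ltr1n// subr_gt0; case/andP: p01.
Qed.

Let loss_ge0 : 0 <= loss. Proof. exact: powR_ge0. Qed.

Lemma powR_half : 2^-1 `^ p = loss / 2.
Proof.
rewrite /loss powRB; last by rewrite pnatr_eq0 implybT.
rewrite powRr1// mulrAC divff ?mul1r ?pnatr_eq0//.
by rewrite -[in LHS]powR_inv1// -powRrM mulN1r powRN.
Qed.

(** Subadditivity leaves the factor [2^-1 ^ p] where an average has [2^-1]; their quotient is
    [loss p]. *)
Lemma powR_average n f x : (forall y, 0 <= f y) ->
  average n f x `^ p <= loss * average n (fun y => f y `^ p) x.
Proof.
move=> f0; rewrite /average powRM ?addr_ge0 ?invr_ge0// powR_half.
by rewrite [leRHS]mulrCA ler_wpM2r ?divr_ge0// powR_addr_le.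
Qed.

(** Pointwise [E_n f] is the average of [E_{n+1} f] over one coordinate, so [powR_average] applies;
    the outer [cexp 0] absorbs the remaining [E_n]. *)
Lemma cexp_powR_step N n f x : cylindrical N f -> (forall y, 0 <= f y) ->
  cexp 0 (fun y => cexp n f y `^ p) x <=
    loss * cexp 0 (fun y => cexp n.+1 f y `^ p) x.
Proof.
move=> cf f0.
pose h y := cexp n.+1 f y `^ p.
have ch : cylindrical n.+1 h.
  exact: (cylindrical_comp (fun t => t `^ p) (@cylindrical_cexp _ n.+1 f)).
have cn : cylindrical n (fun y => cexp n f y `^ p).
  exact: (cylindrical_comp (fun t => t `^ p) (@cylindrical_cexp _ n f)).
rewrite -/h -(cexp_tower ch (leq0n n)).
have c1 : cylindrical 0 (cst loss : walsh_group -> R) by [].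
have -> : loss * cexp 0 (cexp n h) x = cexp 0 (cst loss \* cexp n h) x.
  by rewrite (cexp_mull (@cylindrical_cexp _ n h) c1 (leqnn 0)).
apply: (le_cexp 0 x cn) => [|y /=].
  by apply: cylindrical_comp2 => //; exact: cylindrical_cexp.
rewrite (cexp_step n cf) (cexp_step n ch) (cexp_id ch).
by apply: powR_average => z; exact: cexp_ge0.
Qed.

Lemma cexp_powR_le d n f x : cylindrical (n + d) f -> (forall y, 0 <= f y) ->
  cexp 0 (fun y => cexp n f y `^ p) x <=
    loss ^+ d * cexp 0 (fun y => f y `^ p) x.
Proof.
elim: d => [|d IH] in n *; first by rewrite addn0 => cf _; rewrite expr0 mul1r (cexp_id cf).
rewrite addnS -addSn => cf f0.
apply: le_trans (cexp_powR_step n x cf f0) _.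
by rewrite exprS -mulrA ler_wpM2l// IH.
Qed.

(** A geometric sum dominated by its largest term. The constant is the one for which the induction
    step is an equality. *)
Lemma sum_loss_le d : \sum_(i < d) loss ^+ (d.+1 - i) <=
  loss ^+ 2 / (loss - 1) * loss ^+ d.
Proof.
have l1 : 0 < loss - 1 by rewrite subr_gt0 loss_gt1.
elim: d => [|d IH].
  by rewrite big_ord0 mulr_ge0// divr_ge0 ?exprn_ge0// ltW.
rewrite big_ord_recl subn0.
under eq_bigr => i _ do rewrite lift0 subSS.
rewrite (le_trans (lerD (lexx _) IH))// le_eqVlt; apply/orP; left; apply/eqP.
by rewrite !exprS; field; rewrite gt_eqF.
Qed.

Section partial_sum_estimate.
Variable F : nat -> walsh_group -> R.
Hypothesis mF : is_martingale F.
Let cF := cylindrical_martingale mF.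

Lemma cylindrical_diff n : cylindrical n.+1 (F n.+1 \- F n).
Proof.
apply: (cylindrical_comp2 (fun a b : R => a - b)); first exact: cF.
exact: (cylindrical_le (@cF n) (leqnSn n)).
Qed.

(** The blocks of [S_m F] are computed from [F n.+1], as [m < 2 ^ n.+1]. Each starting frequency
    keeps the top digit [n], so [F n] contributes nothing and may be subtracted. *)
Lemma partial_sum_diff m x : (0 < m)%N -> let n := msb m in
  partial_sum m F x - F n x =
  \sum_(lsb m <= j < n | bit m j) w (floor_exp2 m j.+1) x *
    cexp j (w (floor_exp2 m j.+1) \* (F n.+1 \- F n)) x.
Proof.
move=> m0 n; have /andP[nm mn] := msbP m0; have [lm bl] := lsbP m0.
have := @partial_sum_floor _ _ mF m n.+1 (lsb m) (n - lsb m) x (ltnW mn).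
rewrite subnKC ?leq_lsb_msb// floor_exp2_dvd// floor_exp2_msb// partial_sum_exp2// => ->.
rewrite addrAC subrr add0r; apply: congr_big_nat => // j /and3P[_ _ jn].
set a := floor_exp2 m j.+1.
have am : (2 ^ n <= a < 2 ^ n.+1)%N.
  by rewrite floor_exp2_ge//= (leq_ltn_trans (floor_exp2_le m j.+1)).
have cwa : cylindrical n.+1 (w a) by apply: cylindrical_walsh; case/andP: am.
have cd := @cylindrical_diff n.
have c1 := cylindricalM cwa cd.
have c2 := cylindricalM cwa (cylindrical_le (@cF n) (leqnSn n)).
congr (_ * _).
rewrite (_ : w a \* F n.+1 = (w a \* (F n.+1 \- F n)) \+ (w a \* F n)); last first.
  by apply/funext => y /=; rewrite mulrBr subrK.
by rewrite (cexpD j c1 c2) (cexp_walsh_high mF am (ltnW jn)) /= addr0.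
Qed.

(** Here [cexp 0] serves as the integral over the group. Walsh functions have modulus 1, so each
    block is at most [E_j |F_{n+1} - F_n|]; the blocks are separated by subadditivity of the power
    and their losses summed geometrically. *)
Lemma partial_sum_estimate m x : (0 < m)%N ->
  cexp 0 (fun y => `|partial_sum m F y - F (msb m) y| `^ p) x <=
    loss ^+ 2 / (loss - 1) * loss ^+ bitspan m *
    cexp 0 (fun y => `|F (msb m).+1 y - F (msb m) y| `^ p) x.
Proof.
set n := msb m; move=> m0; have /andP[nm mn] := msbP m0.
have cSm : cylindrical n.+1 (partial_sum m F).
  by apply: cylindrical_partial_sum; exact: ltnW.
pose G y : R := `|F n.+1 y - F n y|.
have cd := @cylindrical_diff n.
have cG : cylindrical n.+1 G := cylindrical_comp Num.norm cd.
have cGp j : cylindrical j (fun y => cexp j G y `^ p).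
  exact: (cylindrical_comp (fun t => t `^ p) (@cylindrical_cexp _ j G)).
have cpG j : (lsb m <= j < n)%N -> cylindrical n.+1 (fun y => cexp j G y `^ p).
  by move=> /andP[_ jn]; exact: (cylindrical_le (cGp j) (leqW (ltnW jn))).
have cS : cylindrical n.+1 (fun y => `|partial_sum m F y - F n y| `^ p).
  apply: (cylindrical_comp2 (fun s t => `|s - t| `^ p)).
    exact: cSm.
  exact: (cylindrical_le (@cF n) (leqnSn n)).
have bound y : `|partial_sum m F y - F n y| <= \sum_(lsb m <= j < n) cexp j G y.
  rewrite partial_sum_diff// (le_trans (ler_norm_sum _ _ _))//.
  rewrite big_mkcond ler_sum_nat//= => j /andP[_ jn].
  case: ifP => _; last by apply: cexp_ge0 => z; exact: normr_ge0.
  rewrite normrM norm_walsh mul1r.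
  set a := floor_exp2 m j.+1.
  have cwa : cylindrical n.+1 (w a).
    by apply: cylindrical_walsh; rewrite (leq_ltn_trans (floor_exp2_le m j.+1)).
  rewrite (le_trans (norm_cexp _ _ (cylindricalM cwa cd)))//.
  by under eq_fun do rewrite /= normrM norm_walsh mul1r.
apply: (@le_trans _ R (\sum_(lsb m <= j < n) cexp 0 (fun y => cexp j G y `^ p) x)).
  (* The range moves into the predicate, so that [j < n] is available when the level of each term is
     checked. *)
  rewrite !big_nat.
  rewrite -(@cexp_sum R n.+1)//.
  apply: (le_cexp 0 x cS) => [|y].
    apply: cylindrical_sum; exact: cpG.
  apply: le_trans (powR_sum_le _ _) => [|j _]; last first.
    by apply: cexp_ge0 => z; exact: normr_ge0.
  apply: ge0_ler_powR; rewrite ?nnegrE ?(ltW p0)//; last by rewrite -big_nat.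
  by apply: sumr_ge0 => j _; apply: cexp_ge0 => z; exact: normr_ge0.
(* Going from level [n.+1], that of [G], down to level [j] averages out [n.+1 - j] coordinates. *)
apply: (@le_trans _ R (\sum_(lsb m <= j < n) loss ^+ (n.+1 - j) *
    cexp 0 (fun y => G y `^ p) x)).
  apply: ler_sum_nat => j /andP[_ jn]; apply: cexp_powR_le => [|z]; last exact: normr_ge0.
  by rewrite subnKC// ltnW// ltnS ltnW.
rewrite -mulr_suml ler_wpM2r//; first by apply: cexp_ge0 => y; exact: powR_ge0.
apply: le_trans (sum_loss_le (bitspan m)).
rewrite -[in leLHS](add0n (lsb m)) big_addn big_mkord /bitspan -/n.
rewrite le_eqVlt; apply/orP; left; apply/eqP; apply: eq_bigr => i _; congr (_ ^+ _).
by have := leq_lsb_msb m0; have := ltn_ord i; rewrite -/n; lia.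
Qed.

End partial_sum_estimate.

End Lp_estimates.

(** * Part (a) *)

Section Hp.
Variables (R : realType) (p : R).
Hypothesis p01 : 0 < p < 1.
Implicit Types (f g u : walsh_group -> R) (F : nat -> walsh_group -> R).
Local Notation mu := (haar R).

Let p0 : 0 < p. Proof. by case/andP: p01. Qed.

Lemma maximal_ge F n x : (`|F n x|%:E <= maximal F x)%E.
Proof. by apply: ereal_sup_ubound; exists n. Qed.

Lemma maximal_le F x y : (forall n, (`|F n x|%:E <= y)%E) -> (maximal F x <= y)%E.
Proof. by move=> Fy; apply: ge_ereal_sup => _ [n _ <-]. Qed.

Lemma maximal_ge0 F x : (0 <= maximal F x)%E.
Proof. by apply: le_trans (maximal_ge F 0 x); rewrite lee_fin. Qed.

Lemma measurable_maximal F : (forall n, measurable_fun setT (F n)) ->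
  measurable_fun [set: walsh_group] (maximal F : walsh_group -> \bar R).
Proof.
move=> mF; pose h n x := (`|F n x|%:E : \bar R).
have mh n : measurable_fun setT (h n).
  by apply/measurable_EFinP; exact: measurableT_comp.
rewrite (_ : maximal F = fun x => esups (h ^~ x) 0).
  exact: measurable_fun_esups.
apply/funext => x; rewrite /maximal /esups /sdrop; congr ereal_sup.
by apply/seteqP; split=> _ [n _ <-]; exists n.
Qed.

(** The [p]-th power of the quasi-norm, which unlike the quasi-norm itself is subadditive for
    [p < 1]. *)
Definition Hp_pow F : \bar R := (\int[mu]_x (maximal F x `^ p))%E.

Lemma Hp_pow_ge0 F : (0 <= Hp_pow F)%E.
Proof. by apply: integral_ge0 => x _; exact: poweR_ge0. Qed.

Lemma Hp_normE F : Hp_norm p F = (Hp_pow F `^ p^-1)%E.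
Proof.
rewrite /Hp_norm unlock /Hp_pow; congr (_ `^ _)%E.
by apply: eq_integral => x _; rewrite gee0_abs// maximal_ge0.
Qed.

Lemma measurable_maximal_pow F : (forall n, measurable_fun setT (F n)) ->
  measurable_fun [set: walsh_group] (fun x => maximal F x `^ p : \bar R)%E.
Proof.
move=> mF; apply: (measurableT_comp (measurable_poweR p)).
exact: measurable_maximal.
Qed.

Lemma poweR_mono (r : R) (y z : \bar R) : 0 <= r -> (0 <= y)%E -> (y <= z)%E ->
  (y `^ r <= z `^ r)%E.
Proof.
move=> r0 y0 yz; apply: gt0_ler_poweR => //; rewrite in_itv/= ?leey ?andbT//.
exact: le_trans yz.
Qed.

Lemma poweR_addr_le (a : R) (y : \bar R) : 0 <= a -> (0 <= y)%E ->
  ((a%:E + y) `^ p <= a%:E `^ p + y `^ p)%E.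
Proof.
move=> a0; case: y => [b|_|]//; last first.
  by rewrite addey// poweRyr ?gt_eqF// addey// poweR_EFin.
by rewrite lee_fin => b0; rewrite -EFinD !poweR_EFin -EFinD lee_fin powR_addr_le.
Qed.

Lemma martingale_ofE N f j : cylindrical N f -> martingale_of f j = cexp j f.
Proof. by move=> cf; rewrite /martingale_of (condexpE j cf). Qed.

Section martingale_bounds.
Variable F : nat -> walsh_group -> R.
Hypothesis mF : is_martingale F.
Let cF := cylindrical_martingale mF.

(** The martingale whose quasi-norm is [omega p n F]; by [tailE] it is [F] minus [F] stopped at time
    [n]. *)
Definition tail n : nat -> walsh_group -> R :=
  fun j x => F j x - martingale_of (partial_sum (2 ^ n) F) j x.

Lemma tailE n j x : tail n j x = F j x - F (minn j n) x.
Proof.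
rewrite /tail (partial_sum_exp2 mF) (martingale_ofE j (@cF n)).
have [jn|nj] := leqP j n; first by rewrite (cexp_martingale mF).
by rewrite cexp_id//; exact: (cylindrical_le (@cF n) (ltnW nj)).
Qed.

Lemma measurable_tail n j : measurable_fun setT (tail n j).
Proof.
rewrite (_ : tail n j = F j \- F (minn j n)); last first.
  by apply/funext => x; rewrite tailE.
by apply: measurable_funB; exact: cylindrical_measurable (@cF _).
Qed.

Lemma cexp_partial_sum m n : (2 ^ n <= m <= 2 ^ n.+1)%N ->
  cexp n (partial_sum m F) = F n.
Proof.
move=> /andP[nm mn]; apply/funext => x.
have -> : partial_sum m F =
    F n \+ (fun y => \sum_(2 ^ n <= k < m) walsh_coef F k * walsh R k y).
  apply/funext => y; rewrite -[F n](partial_sum_exp2 mF) /= /partial_sum.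
  by rewrite -big_cat_nat.
have cw k : (2 ^ n <= k < m)%N ->
    cylindrical n.+1 (fun y => walsh_coef F k * walsh R k y).
  move=> /andP[_ km]; apply: (cylindrical_comp (fun t : R => walsh_coef F k * t)).
  by apply: cylindrical_walsh; rewrite (leq_trans km).
under [X in F n \+ X]eq_fun do rewrite big_nat.
have cs := cylindrical_sum (index_iota (2 ^ n) m) cw.
rewrite (cexpD n (cylindrical_le (@cF n) (leqnSn n)) cs) /= cexp_id//.
rewrite (cexp_sum _ _ _ cw) big1 ?addr0// => k /andP[nk km].
have cwk : cylindrical n.+1 (walsh R k).
  by apply: cylindrical_walsh; rewrite (leq_trans km).
have c0 : cylindrical 0 (cst (walsh_coef F k) : walsh_group -> R) by [].
have -> : (fun y => walsh_coef F k * walsh R k y) = cst (walsh_coef F k) \* walsh R k.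
  by [].
rewrite (cexp_mull cwk c0 (leq0n n)) cexp_walsh ?nk ?(leq_trans km)//.
by rewrite /= mulr0.
Qed.

(** For [j <= msb m] the conditional expectation of [S_m F] is [F j], since the frequencies from
    [2 ^ msb m] on are averaged out; for larger [j] the sum already has level [j]. *)
Lemma sum_errorE m j x : (0 < m)%N ->
  sum_error m F j x = if (j <= msb m)%N then 0 else partial_sum m F x - F j x.
Proof.
move=> m0; have /andP[nm mn] := msbP m0.
have cS : cylindrical (msb m).+1 (partial_sum m F).
  by apply: cylindrical_partial_sum; exact: ltnW.
rewrite /sum_error (martingale_ofE j cS); case: ifPn => [jn|].
  have nmn : (2 ^ msb m <= m <= 2 ^ (msb m).+1)%N by rewrite nm ltnW.
  rewrite -(cexp_tower cS jn) (cexp_partial_sum nmn) (cexp_martingale mF jn).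
  by rewrite subrr.
by rewrite -ltnNge => nj; rewrite cexp_id//; exact: (cylindrical_le cS nj).
Qed.

Lemma Hp_pow_diff_le n :
  (\int[mu]_x (`|F n.+1 x - F n x| `^ p)%:E <= Hp_pow (tail n))%E.
Proof.
apply: ge0_le_integral => //.
- apply/measurable_EFinP; apply: (cylindrical_measurable (n := n.+1)).
  exact: (cylindrical_comp (fun t => `|t| `^ p) (@cylindrical_diff _ _ mF n)).
- by apply: measurable_maximal_pow; exact: measurable_tail.
move=> x _; rewrite -poweR_EFin; apply: poweR_mono; rewrite ?(ltW p0) ?lee_fin//.
by have := maximal_ge (tail n) n.+1 x; rewrite tailE (minn_idPr (leqnSn n)).
Qed.

Let C := loss p ^+ 2 / (loss p - 1).
Let C_ge0 : 0 <= C.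
Proof. by rewrite divr_ge0 ?exprn_ge0 ?powR_ge0// subr_ge0 ltW// loss_gt1. Qed.

(** For [j > n] write [S_m F - F_j] as [(S_m F - F_n) - (F_j - F_n)]. The first term is independent
    of [j] and falls under [partial_sum_estimate]; the second is at most the maximal function of
    [tail n] and accounts for the summand 1. *)
Lemma Hp_pow_sum_error m : (0 < m)%N ->
  (Hp_pow (sum_error m F) <=
    (C * loss p ^+ bitspan m + 1)%:E * Hp_pow (tail (msb m)))%E.
Proof.
move=> m0; set n := msb m; have /andP[nm mn] := msbP m0.
pose D x := `|partial_sum m F x - F n x|.
have cS : cylindrical n.+1 (partial_sum m F).
  by apply: cylindrical_partial_sum; exact: ltnW.
have cD : cylindrical n.+1 D.
  apply: (cylindrical_comp2 (fun s t : R => `|s - t|)) => //.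
  exact: (cylindrical_le (@cF n) (leqnSn n)).
have cDp : cylindrical n.+1 (fun x => D x `^ p).
  exact: (cylindrical_comp (fun t => t `^ p) cD).
have merr j : measurable_fun setT (sum_error m F j).
  apply: (cylindrical_measurable (n := maxn n.+1 j)).
  rewrite (_ : sum_error m F j =
      if (j <= n)%N then cst 0 else fun x => partial_sum m F x - F j x).
    case: ifP => _ //; apply: (cylindrical_comp2 (fun s t : R => s - t)).
      exact: (cylindrical_le cS (leq_maxl _ _)).
    exact: (cylindrical_le (@cF j) (leq_maxr _ _)).
  by apply/funext => x; rewrite sum_errorE//; case: ifP.
have K0 : 0 <= C * loss p ^+ bitspan m by rewrite mulr_ge0// exprn_ge0// powR_ge0.
rewrite EFinD ge0_muleDl ?lee_fin// mul1e.
apply: (@le_trans _ _ (\int[mu]_x ((D x `^ p)%:E + maximal (tail n) x `^ p))%E).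
  apply: ge0_le_integral => //.
  - by move=> x _; exact: poweR_ge0.
  - exact: measurable_maximal_pow.
  - apply: emeasurable_funD; last first.
      by apply: measurable_maximal_pow; exact: measurable_tail.
    by apply/measurable_EFinP; exact: cylindrical_measurable cDp.
  move=> x _; rewrite -poweR_EFin.
  apply: le_trans (poweR_addr_le (normr_ge0 _) (maximal_ge0 _ _)).
  apply: poweR_mono; rewrite ?(ltW p0) ?maximal_ge0//.
  apply: maximal_le => j; rewrite sum_errorE//; case: ifPn => [_|].
    by rewrite normr0 adde_ge0// ?maximal_ge0// lee_fin.
  rewrite -ltnNge => nj.
  have := maximal_ge (tail n) j x; rewrite tailE (minn_idPr (ltnW nj)).
  move=> /(leeD2l (D x)%:E); apply: le_trans.
  rewrite -EFinD lee_fin -[F j x - F n x]opprB normrN.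
  by rewrite (le_trans _ (ler_normD _ _))// addrA subrK.
rewrite ge0_integralD//.
- rewrite leeD2r//; apply: le_trans (lee_wpmul2l _ (Hp_pow_diff_le n)); last first.
    by rewrite lee_fin.
  rewrite (integral_cylindrical cDp)//.
  have cGp : cylindrical n.+1 (fun x => `|F n.+1 x - F n x| `^ p).
    exact: (cylindrical_comp (fun t => `|t| `^ p) (@cylindrical_diff _ _ mF n)).
  rewrite (integral_cylindrical cGp)// -EFinM lee_fin -!(cexp0E _ point).
  exact: partial_sum_estimate.
- by move=> x _; rewrite lee_fin powR_ge0.
- by apply/measurable_EFinP; exact: cylindrical_measurable cDp.
- by move=> x _; exact: poweR_ge0.
- by apply: measurable_maximal_pow; exact: measurable_tail.
Qed.

Lemma loss_root d : (loss p ^+ d) `^ p^-1 = 2 `^ (d%:R * (1 / p - 1)).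
Proof.
rewrite -powR_mulrn ?powR_ge0// /loss -!powRrM; congr (_ `^ _).
by field; rewrite gt_eqF.
Qed.

Lemma Hp_norm_sum_error m : (0 < m)%N ->
  (Hp_norm p (sum_error m F) <=
    ((C + 1) `^ p^-1 * 2 `^ ((bitspan m)%:R * (1 / p - 1)))%:E *
      omega p (msb m) F)%E.
Proof.
move=> m0; rewrite -loss_root /omega -/(tail _) !Hp_normE.
have C1 : 0 <= C + 1 by rewrite addr_ge0.
have ld0 : 0 <= loss p ^+ bitspan m by rewrite exprn_ge0// powR_ge0.
rewrite -powRM// -poweR_EFin -poweRM ?Hp_pow_ge0 ?lee_fin ?mulr_ge0//.
apply: poweR_mono; rewrite ?invr_ge0 ?(ltW p0) ?Hp_pow_ge0//.
apply: (le_trans (Hp_pow_sum_error m0)).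
(* The summand 1 is absorbed into a power of [loss p], which is at least 1. *)
rewrite lee_wpmul2r ?Hp_pow_ge0// lee_fin mulrDl lerD2l mul1r.
by rewrite exprn_ege1// ltW// loss_gt1.
Qed.

End martingale_bounds.

Theorem partial_sums_cvg_Hp F (m : nat -> nat) :
  in_Hp p F -> (forall k, (0 < m k)%N) ->
  is_little_o (fun k => omega p (msb (m k)) F)
    (fun k => 1 / 2 `^ ((bitspan (m k))%:R * (1 / p - 1))) ->
  (fun k => Hp_norm p (sum_error (m k) F)) @ \oo --> 0%E.
Proof.
move=> [mF _] m0 o_omega.
pose A : R := (loss p ^+ 2 / (loss p - 1) + 1) `^ p^-1.
have A0 : 0 < A.
  rewrite powR_gt0// ltr_wpDl// divr_ge0 ?exprn_ge0 ?powR_ge0//.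
  by rewrite subr_ge0 ltW// loss_gt1.
have small e : 0 < e ->
    \forall k \near \oo, (Hp_norm p (sum_error (m k) F) <= e%:E)%E.
  (* [A] is the constant of [Hp_norm_sum_error], and the power of 2 there cancels the one in the
     hypothesis. *)
  move=> e0; have := o_omega (e / A) (divr_gt0 e0 A0); apply: filterS => k /=.
  have om0 : (0 <= omega p (msb (m k)) F)%E by exact: Lnorm_ge0.
  set c : R := 2 `^ _; have c0 : 0 < c by exact: powR_gt0.
  rewrite gee0_abs// mul1r ger0_norm ?invr_ge0 ?(ltW c0)// => omk.
  apply: (le_trans (Hp_norm_sum_error mF (m0 k))).
  apply: (le_trans (lee_wpmul2l _ omk)); first by rewrite lee_fin mulr_ge0// ltW.
  by rewrite -EFinM lee_fin -/c -/A le_eqVlt; apply/orP; left;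
    apply/eqP; field; rewrite !gt_eqF.
apply/fine_cvgP; split.
  apply: filterS (small 1 ltr01) => k k1.
  by rewrite ge0_fin_numE ?Lnorm_ge0// (le_lt_trans k1) ?ltry.
apply/cvgrPdist_le => e e0; apply: filterS (small e e0) => k ke.
rewrite sub0r normrN /= ger0_norm ?fine_ge0 ?Lnorm_ge0//.
by rewrite -lee_fin fineK// ge0_fin_numE ?Lnorm_ge0// (le_lt_trans ke) ?ltry.
Qed.

End Hp.

(** * Part (b) *)

Section selection.
Variable R : realType.

Lemma sup_nat_unbounded (u : nat -> nat) :
  ereal_sup (range (fun k => ((u k)%:R : R)%:E)) = +oo%E ->
  forall N K, exists2 k, (K <= k)%N & (N < u k)%N.
Proof.
move=> supu N K; apply: contrapT => noK.
(* If the claim fails, [N] bounds [u] from [K] on and the sum bounds its first [K] values. *)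
suff : (ereal_sup (range (fun k => ((u k)%:R : R)%:E)) <=
    ((N + \sum_(i < K) u i)%N%:R : R)%:E)%E by rewrite supu leye_eq.
apply: ge_ereal_sup => _ [k _ <-]; rewrite lee_fin ler_nat.
have [Kk|kK] := leqP K k; last by rewrite (bigD1 (Ordinal kK))//= addnCA leq_addr.
rewrite (leq_trans _ (leq_addr _ _))// leqNgt; apply/negP => Nk.
by apply: noK; exists k.
Qed.

Lemma lacunary_subsequence (d n : nat -> nat) :
  (forall N K, exists2 k, (K <= k)%N & (N < d k)%N) ->
  exists phi : nat -> nat, [/\ {homo phi : i j / (i < j)%N},
    forall k, (0 < d (phi k))%N & forall k, (n (phi k) < d (phi k.+1))%N].
Proof.
move=> unb; have /choice[s sP] : forall k, exists k',
    [/\ (k < k')%N, (0 < d k')%N & (n k < d k')%N].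
  move=> k; have [k' kk' nk'] := unb (n k) k.+1.
  by exists k'; split=> //; exact: leq_ltn_trans nk'.
(* Starting at [s 0] rather than 0 makes [d] positive at the first term too. *)
exists (fun i => iter i.+1 s 0%N); split=> [|k|k].
- by apply: homo_ltn => [? ? ?|i]; [exact: ltn_trans|case: (sP (iter i.+1 s 0%N))].
- by case: (sP (iter k s 0%N)).
- by case: (sP (iter k.+1 s 0%N)).
Qed.

End selection.

(** * The counterexample martingale and its partial sums *)

Section rademacher_martingale.
Variables (R : realType) (c : nat -> R).

Definition zeros (n : nat) : set walsh_group := dyadic_cylinder n (fun=> false).

Local Notation ind n := (\1_(zeros n) : walsh_group -> R).

Definition rademacher_martingale j (x : walsh_group) : R :=
  \sum_(t < j) c t * rademacher R t x * \1_(zeros t) x.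
Local Notation F := rademacher_martingale.

Lemma cylindrical_zeros n : cylindrical n (ind n).
Proof.
move=> x y xy; rewrite !indicE; congr ((nat_of_bool _)%:R).
apply/idP/idP; rewrite !inE => h; first exact: cylinder_trans h (cylinder_sym xy).
exact: cylinder_trans h xy.
Qed.

Lemma measurable_zeros n : measurable (zeros n).
Proof. exact: measurable_cylinder. Qed.

Lemma zeros_le m n x : (m <= n)%N -> zeros n x -> zeros m x.
Proof. by move=> mn xn k km; apply: xn; exact: leq_trans mn. Qed.

Lemma rademacher_martingaleS j :
  F j.+1 = F j \+ ((c j \*o ind j) \* rademacher R j).
Proof.
apply/funext => x; rewrite /rademacher_martingale big_ord_recr /=.
by congr (_ + _); rewrite mulrAC.
Qed.

Lemma cylindrical_scaled_zeros j : cylindrical j (c j \*o ind j).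
Proof. exact: (cylindrical_comp (fun t : R => c j * t) (@cylindrical_zeros j)). Qed.

Lemma cylindrical_rademacher_martingale j : cylindrical j (F j).
Proof.
elim: j => [x y _|j IH]; first by rewrite /rademacher_martingale !big_ord0.
rewrite rademacher_martingaleS; apply: cylindrical_comp2.
  exact: (cylindrical_le IH (leqnSn j)).
have := cylindricalM (@cylindrical_scaled_zeros j) (@cylindrical_rademacher R j).
by rewrite (maxn_idPr (leqnSn j)).
Qed.

Lemma is_martingale_rademacher : is_martingale F.
Proof.
apply/is_martingaleP => j; split; first exact: cylindrical_rademacher_martingale.
have c1 := cylindricalM (@cylindrical_scaled_zeros j) (@cylindrical_rademacher R j).
rewrite (maxn_idPr (leqnSn j)) in c1.
have c2 := cylindrical_le (@cylindrical_rademacher_martingale j) (leqnSn j).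
rewrite rademacher_martingaleS (cexpD j c2 c1).
rewrite (cexp_mull (@cylindrical_rademacher R j) (@cylindrical_scaled_zeros j) (leqnn j)).
rewrite cexp_rademacher (cexp_id (@cylindrical_rademacher_martingale j)).
by apply/funext => x; rewrite /= mulr0 addr0.
Qed.

Lemma rademacher_martingale_diff n j x : (n <= j)%N ->
  F j x - F n x = \sum_(n <= t < j) c t * rademacher R t x * \1_(zeros t) x.
Proof.
move=> nj; rewrite /rademacher_martingale.
rewrite -!(big_mkord xpredT (fun t => c t * rademacher R t x * \1_(zeros t) x)).
by rewrite (@big_cat_nat _ _ _ n)//= addrAC subrr add0r.
Qed.

(** A cylinder of level [j <= n] either contains [zeros n] or is disjoint from it. *)
Lemma cexp_zeros j n x : (j <= n)%N ->
  cexp j (ind n) x = 2 ^+ j / 2 ^+ n * \1_(zeros j) x.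
Proof.
move=> jn; rewrite /cexp -mulrA; congr (_ * _).
rewrite /Rintegral integral_indic; [|exact: measurable_cylinder|exact: measurable_zeros].
rewrite indicE; have [|xj] := boolP (x \in zeros j).
  rewrite inE => xj; rewrite setIidl ?[X in fine X]haar_cylinder ?mulr1//.
  move=> y /(zeros_le jn) yj.
  by apply: cylinder_trans yj; exact: cylinder_sym.
rewrite (_ : _ `&` _ = set0) ?measure0 ?mulr0//.
apply/seteqP; split=> // y [/(zeros_le jn) yj /cylinder_sym yx].
by move/negP: xj; apply; rewrite inE; exact: cylinder_trans yj yx.
Qed.

Lemma walsh_zeros n a x : (2 ^ n <= a < 2 ^ n.+1)%N -> zeros n x ->
  walsh R a x = rademacher R n x.
Proof.
move=> /(walsh_top R)[b bn ->] xn /=.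
rewrite (@cylindrical_walsh R n b bn _ _ xn) /walsh big1 ?mul1r// => k _.
by rewrite /rademacher expr0 expr1n.
Qed.

Lemma rademacher_martingale_const n j x : ~ zeros n x -> (n <= j)%N -> F j x = F n x.
Proof.
move=> xn nj; apply/eqP; rewrite -subr_eq0 rademacher_martingale_diff//.
rewrite big_nat big1// => t /andP[nt _].
by rewrite indicE memNset ?mulr0// => /(zeros_le nt).
Qed.

(** On [zeros n] every [w_a] with top digit [n] equals [rademacher R n], so multiplying the
    increment by it leaves [c n] times the indicator. Block [j] is then [c n * 2 ^ (j - n)] on
    [zeros j], up to sign, and only [j = lsb m] survives at [x]. *)
Lemma rademacher_partial_sum m x : (0 < m)%N -> (lsb m < msb m)%N ->
  zeros (lsb m) x -> ~ zeros (lsb m).+1 x ->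
  `|partial_sum m F x - F (msb m) x| = `|c (msb m)| * (2 ^+ lsb m / 2 ^+ msb m).
Proof.
move=> m0 lm xl xl1; set n := msb m; have /andP[nm mn] := msbP m0.
have term j : (j < n)%N -> walsh R (floor_exp2 m j.+1) x *
    cexp j (walsh R (floor_exp2 m j.+1) \* (F n.+1 \- F n)) x =
    walsh R (floor_exp2 m j.+1) x * (c n * (2 ^+ j / 2 ^+ n * ind j x)).
  move=> jn; set a := floor_exp2 m j.+1; congr (_ * _).
  have an : (2 ^ n <= a < 2 ^ n.+1)%N.
    by rewrite floor_exp2_ge//= (leq_ltn_trans (floor_exp2_le m j.+1)).
  rewrite (_ : _ \* _ = cst (c n) \* ind n).
    have c0 : cylindrical 0 (cst (c n) : walsh_group -> R) by [].
    by rewrite (cexp_mull (@cylindrical_zeros n) c0 (leq0n j)) /= cexp_zeros// ltnW.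
  apply/funext => y; rewrite rademacher_martingaleS /= addrAC subrr add0r indicE.
  have [yn|_] := boolP (y \in zeros n); last by rewrite !mulr0 mul0r mulr0.
  rewrite inE in yn.
  by rewrite (walsh_zeros an yn) mulrCA rademacher_sqr !mulr1.
rewrite (partial_sum_diff is_martingale_rademacher)// big_ltn_cond//.
rewrite (lsbP m0).2 term// big_nat_cond big1 ?addr0.
  by rewrite indicE mem_set// mulr1 !normrM norm_walsh mul1r normfV !normrX !normr_nat.
move=> j /andP[/andP[lj jn] _]; rewrite term// indicE memNset ?mulr0//.
by move/(zeros_le lj).
Qed.

End rademacher_martingale.

(** * Strong and weak quasi-norms for the counterexample *)

Section rademacher_martingale_norms.
Variables (R : realType) (p : R) (c : nat -> R).
Hypothesis p01 : 0 < p < 1.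
Hypothesis c_ge0 : forall t, 0 <= c t.
Local Notation mu := (haar R).
Local Notation ind n := (\1_(zeros n) : walsh_group -> R).
Local Notation F := (rademacher_martingale c).
Let mF : is_martingale F := is_martingale_rademacher c.
Let cF : forall n, cylindrical n (F n) := cylindrical_martingale mF.

Let p0 : 0 < p. Proof. by case/andP: p01. Qed.

Lemma powR_indic (A : set walsh_group) x : (\1_A x : R) `^ p = \1_A x.
Proof. by rewrite indicE; case: (_ \in _); rewrite ?powR1// powR0// gt_eqF. Qed.

Lemma tail_powR_le n j x :
  `|tail F n j x| `^ p <= \sum_(n <= t < j) c t `^ p * \1_(zeros t) x.
Proof.
rewrite (tailE mF); have [jn|nj] := leqP j n.
  by rewrite subrr normr0 powR0 ?gt_eqF// big_geq.
rewrite rademacher_martingale_diff ?(ltnW nj)//.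
have ci0 t : 0 <= c t * \1_(zeros t) x by rewrite mulr_ge0.
apply: (@le_trans _ _ ((\sum_(n <= t < j) c t * \1_(zeros t) x) `^ p)).
  apply: ge0_ler_powR; rewrite ?nnegrE ?(ltW p0) ?sumr_ge0//.
  apply: (le_trans (ler_norm_sum _ _ _)); apply: ler_sum => t _.
  rewrite !normrM /rademacher normr_sign mulr1 !ger0_norm//.
apply: le_trans; first by apply: powR_sum_le.
by apply: ler_sum => t _; rewrite powRM// powR_indic.
Qed.

(** The [p]-th power of the maximal function is dominated by a series of weighted indicators,
    integrated term by term with [zeros t] of mass [2 ^- t]. *)
Lemma Hp_pow_tail_le n W :
  (forall N, \sum_(n <= t < N) c t `^ p / 2 ^+ t <= W) ->
  (Hp_pow p (tail F n) <= W%:E)%E.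
Proof.
move=> sumW.
(* Extending the weights by 0 below [n] lets the series start at 0. *)
pose a t := if (n <= t)%N then c t `^ p else 0.
have a0 t : 0 <= a t by rewrite /a; case: ifP => _; rewrite ?powR_ge0.
have sum_a (h : nat -> R) N :
    \sum_(0 <= t < N) a t * h t = \sum_(n <= t < N) c t `^ p * h t.
  rewrite (big_nat_widenl n 0)// [RHS]big_mkcond.
  by apply: eq_bigr => t _; rewrite /a; case: ifP; rewrite ?mul0r.
pose g t x := (a t * ind t x)%:E.
have g0 t x : (0 <= g t x)%E by rewrite lee_fin mulr_ge0.
have mg t : measurable_fun setT (g t).
  apply/measurable_EFinP; apply: measurable_funM => //.
  by apply: measurable_indic; exact: measurable_zeros.
have mtail := measurable_tail mF n.
have bound x : (maximal (tail F n) x `^ p <= \sum_(t <oo) g t x)%E.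
  set S := (\sum_(t <oo) _)%E.
  have S0 : (0 <= S)%E by apply: nneseries_ge0.
  (* The supremum sits inside the power, so the comparison is made between [p]-th roots, one index
     [j] at a time. *)
  have -> : S = ((S `^ p^-1) `^ p)%E by rewrite -poweRrM mulVf ?gt_eqF// poweRe1.
  apply: poweR_mono; rewrite ?(ltW p0) ?maximal_ge0//; apply: maximal_le => j.
  have -> : (`|tail F n j x|%:E = (`|tail F n j x| `^ p)%:E `^ p^-1)%E.
    by rewrite poweR_EFin -powRrM mulfV ?gt_eqF// powRr1.
  apply: poweR_mono; rewrite ?invr_ge0 ?(ltW p0) ?lee_fin ?powR_ge0//.
  apply: (@le_trans _ _ (\sum_(0 <= t < j) g t x)%E); last exact: nneseries_lim_ge.
  by rewrite /g sumEFin lee_fin sum_a tail_powR_le.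
apply: (@le_trans _ _ (\int[mu]_x (\sum_(t <oo) g t x))%E).
  apply: ge0_le_integral => //.
  - by move=> x _; exact: poweR_ge0.
  - exact: measurable_maximal_pow.
  - exact: ge0_emeasurable_sum.
rewrite integral_nneseries//.
apply: lime_le; first by apply: is_cvg_nneseries => t _ _; exact: integral_ge0.
apply: nearW => N.
have intg t : (\int[mu]_x g t x = (a t / 2 ^+ t)%:E)%E.
  rewrite /g; under eq_integral do rewrite EFinM.
  rewrite ge0_integralZl_EFin//; last first.
    by apply/measurable_EFinP; apply: measurable_indic; exact: measurable_zeros.
  rewrite integral_indic//; last exact: measurable_zeros.
  by rewrite setIT EFinM; congr (_ * _)%E; exact: haar_cylinder.
under eq_bigr do rewrite intg.
by rewrite sumEFin lee_fin sum_a.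
Qed.

Lemma weak_norm_ge (f : walsh_group -> R) (v : R) (A : set walsh_group) :
  0 < v -> measurable A ->
  measurable [set x | v < `|f x|] -> A `<=` [set x | v < `|f x|] ->
  ((v `^ p)%:E * mu A <= weak_norm p f `^ p)%E.
Proof.
move=> v0 mA mB AB; rewrite /weak_norm -poweRrM mulVf ?gt_eqF// poweRe1; last first.
  apply: ereal_sup_ge; exists ((v `^ p)%:E * mu [set x | (v < `|f x|)%R])%E.
    by exists v.
  by rewrite mule_ge0// lee_fin powR_ge0.
apply: ereal_sup_ge; exists ((v `^ p)%:E * mu [set x | (v < `|f x|)%R])%E.
  by exists v.
by rewrite lee_wpmul2l ?lee_fin ?powR_ge0// le_measure ?inE.
Qed.

Lemma limit_sum_error m N x : (0 < m)%N -> (msb m < N)%N -> ~ zeros N x ->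
  martingale_limit (sum_error m F) x = partial_sum m F x - F N x.
Proof.
move=> m0 mN xN; apply: lim_near_cst => //; exists N => // j /= Nj.
rewrite (sum_errorE mF)// leqNgt (leq_trans mN Nj)/=.
by rewrite (rademacher_martingale_const c xN Nj).
Qed.

Lemma measurable_limit_sum_error m (v : R) : (0 < m)%N ->
  measurable [set x : walsh_group | v < `|martingale_limit (sum_error m F) x|].
Proof.
move=> m0; set B := [set x | _].
pose E N := ~` zeros ((msb m).+1 + N) `&`
  (fun x => `|partial_sum m F x - F ((msb m).+1 + N)%N x|) @^-1` `]v, +oo[.
have /andP[_ mm] := msbP m0.
(* The zero sequence is set apart, since the martingale need not converge there. Every other point
   leaves [zeros N] for large [N], and there the limit is given by a cylindrical function. *)
rewrite (_ : B = (B `&` [set (fun=> false) : walsh_group]) `|` \bigcup_N E N).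
  apply: measurableU; last first.
    apply: bigcup_measurable => N _; apply: measurableI.
      by apply: measurableC; exact: measurable_zeros.
    rewrite -[X in measurable X]setTI.
    apply: (cylindrical_measurable (n := ((msb m).+1 + N)%N)) => //.
    apply: (cylindrical_comp2 (fun s t : R => `|s - t|)); last exact: cF.
    apply: cylindrical_partial_sum; rewrite (leq_trans (ltnW mm))// leq_exp2l//.
    exact: leq_addr.
  have [B0|B0] := pselect (B (fun=> false)); last first.
    by rewrite (_ : _ `&` _ = set0)//; apply/seteqP; split=> // x [Bx e]; rewrite e in Bx.
  rewrite (_ : _ `&` _ = \bigcap_N zeros N).
    by apply: bigcap_measurable => // N _; exact: measurable_zeros.
  apply/seteqP; split=> [x [_ ->] N _ k _//|x xz].
  have -> : x = fun=> false by apply/funext => k; exact: (xz k.+1 I k (ltnSn k)).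
  by split.
have EP N x : ~ zeros ((msb m).+1 + N) x -> B x = E N x.
  move=> xN; rewrite /B /E/= in_itv/= andbT.
  rewrite (limit_sum_error m0 _ xN) ?leq_addr//.
  by apply/propext; split => [|[]].
apply/seteqP; split=> [x Bx|x [[]//|[N _ EN]]]; last by have [xN _] := EN; rewrite (EP N).
have [[k xk]|noxk] := pselect (exists k, x k).
  right; exists k => //; rewrite -EP// => xz.
  have /xz : (k < (msb m).+1 + k)%N by rewrite addSn ltnS leq_addl.
  by rewrite xk.
by left; split=> //; apply/funext => k; apply/negP => xk; apply: noxk; exists k.
Qed.

End rademacher_martingale_norms.

(** * Geometric sums of lacunary weights *)

Section lacunary_weights.
Variables (R : realFieldType) (q : R) (n d : nat -> nat).
Hypothesis q01 : 0 < q < 1.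
Hypothesis dn : forall k, (d k <= n k)%N.
Hypothesis nd : forall k, (n k < d k.+1)%N.

Let q0 : 0 <= q. Proof. by case/andP: q01 => /ltW. Qed.
Let q1 : 0 < 1 - q. Proof. by rewrite subr_gt0; case/andP: q01. Qed.

(** The function equal to [q ^+ d k] at [n k] and 0 elsewhere. The range [i < t.+1] catches every
    index, since [k <= n k]. *)
Definition lacunary_weight t : R := \sum_(i < t.+1 | n i == t) q ^+ d i.
Local Notation e := lacunary_weight.

Lemma lacunary_homo : {homo n : i j / (i < j)%N}.
Proof.
apply: homo_ltn => [? ? ?|k]; first exact: ltn_trans.
exact: leq_trans (nd k) (dn k.+1).
Qed.

Lemma lacunary_mono : {mono n : i j / (i <= j)%N}.
Proof. exact: leq_mono lacunary_homo. Qed.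

Lemma leq_lacunary k : (k <= n k)%N.
Proof. by elim: k => // k IH; exact: leq_ltn_trans IH (lacunary_homo (ltnSn k)). Qed.

Lemma lacunary_weight_ge0 t : 0 <= e t.
Proof. by apply: sumr_ge0 => i _; exact: exprn_ge0. Qed.

Lemma lacunary_weightE k : e (n k) = q ^+ d k.
Proof.
have kn : (k < (n k).+1)%N by rewrite ltnS leq_lacunary.
rewrite /e (big_pred1 (Ordinal kn))// => i.
by rewrite /= -val_eqE /= !eqn_leq !lacunary_mono.
Qed.

Lemma lacunary_weight0 t : (forall k, n k != t) -> e t = 0.
Proof. by move=> nt; rewrite /e big_pred0// => i; apply/negbTE. Qed.

Lemma lacunary_weight_between k t : (n k < t < n k.+1)%N -> e t = 0.
Proof.
move=> /andP[kt tk]; apply: lacunary_weight0 => i; apply/eqP => it.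
move: kt tk; rewrite -it (leqW_mono lacunary_mono) (leqW_mono lacunary_mono).
by rewrite ltnS ltnNge => /negP.
Qed.

(** As [d] is strictly increasing, [q ^+ d k.+1 <= q * q ^+ d k]; the subtracted term in the bound
    is what makes the induction close. *)
Lemma sum_lacunary_weight k j :
  \sum_(n k <= t < n (k + j)%N) e t <= (q ^+ d k - q ^+ d (k + j)%N) / (1 - q).
Proof.
elim: j => [|j IH]; first by rewrite addn0 big_geq// subrr mul0r.
have nk : (n k <= n (k + j)%N)%N.
  by rewrite lacunary_mono leq_addr.
have nS : (n (k + j)%N < n (k + j).+1)%N by exact: lacunary_homo.
rewrite addnS (@big_cat_nat _ _ _ (n (k + j)%N))//=; last exact: ltnW.
rewrite [X in _ + X]big_ltn// lacunary_weightE.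
rewrite [X in _ + (_ + X)]big_nat [X in _ + (_ + X)]big1 ?addr0; last first.
  by move=> t; exact: lacunary_weight_between.
have dS : (d (k + j) < d (k + j).+1)%N := leq_ltn_trans (dn _) (nd _).
have qd : q ^+ d (k + j).+1 <= q * q ^+ d (k + j).
  rewrite -exprS; apply: ler_wiXn2l => //.
  by case/andP: q01 => _ /ltW.
rewrite ler_pdivlMr// mulrDl; move: IH; rewrite ler_pdivlMr// => IH.
apply: (le_trans (lerD IH (lexx _))); move: qd.
set x := q ^+ _; set y := q ^+ d (k + j); set z := q ^+ d k; move=> yx.
by lra.
Qed.

Lemma sum_lacunary_weight_tail k N :
  \sum_(n k <= t < N) e t <= q ^+ d k / (1 - q).
Proof.
apply: (@le_trans _ _ (\sum_(n k <= t < n (k + N)%N) e t)); last first.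
  apply: (le_trans (sum_lacunary_weight k N)).
  by rewrite ler_pM2r ?invr_gt0// lerBlDr lerDl exprn_ge0.
have [Nk|kN] := leqP N (n k).
  by rewrite big_geq// sumr_ge0// => t _; exact: lacunary_weight_ge0.
rewrite [leRHS](@big_cat_nat _ _ _ N)//=; first last.
- by rewrite (leq_trans (leq_lacunary N))// lacunary_mono leq_addl.
- exact: ltnW.
by rewrite lerDl sumr_ge0// => t _; exact: lacunary_weight_ge0.
Qed.

Lemma sum_lacunary_weight_all N :
  \sum_(0 <= t < N) e t <= q ^+ d 0 / (1 - q).
Proof.
apply: le_trans (sum_lacunary_weight_tail 0 (maxn (n 0) N)).
have small t : (0 <= t < n 0)%N -> e t = 0.
  move=> /andP[_ t0]; apply: lacunary_weight0 => i; apply/eqP => it.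
  by have := lacunary_mono 0 i; rewrite it leq0n leqNgt t0.
have -> : \sum_(n 0 <= t < maxn (n 0) N) e t = \sum_(0 <= t < maxn (n 0) N) e t.
  rewrite [RHS](@big_cat_nat _ _ _ (n 0))//= ?leq_maxl//.
  by rewrite [X in X + _]big_nat [X in X + _]big1 ?add0r.
rewrite [leRHS](@big_cat_nat _ _ _ N)//= ?leq_maxr//.
by rewrite lerDl sumr_ge0// => t _; exact: lacunary_weight_ge0.
Qed.

End lacunary_weights.

(** * The lower bound in weak L_p *)

Section divergence.
Variables (R : realType) (p : R).
Hypothesis p01 : 0 < p < 1.

Let p0 : 0 < p. Proof. by case/andP: p01. Qed.
Let q : R := (loss p)^-1.
Let loss0 : 0 < loss p. Proof. exact: lt_trans ltr01 (loss_gt1 p01). Qed.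

(** This is [2 ^ (- 1 - 1 / p)]: one factor [2^-1] from halving the level, and [2 ^ (- 1 / p)] from
    the mass [2 ^- l.+1]. *)
Definition error_bound : R := (2^-1 `^ p / 2) `^ p^-1.

Lemma error_bound_gt0 : 0 < error_bound.
Proof. by rewrite powR_gt0// divr_gt0// powR_gt0. Qed.

Lemma powR_exprn (x : R) d : 0 <= x -> (x ^+ d) `^ p = (x `^ p) ^+ d.
Proof. by move=> x0; rewrite -powR_mulrn// powRAC powR_mulrn// powR_ge0. Qed.

Lemma weak_norm_sum_error_ge (c : nat -> R) m : (forall t, 0 <= c t) ->
  (0 < bitspan m)%N ->
  c (msb m) `^ p = 2 ^+ msb m * q ^+ bitspan m ->
  (error_bound%:E <=
    weak_norm p (martingale_limit (sum_error m (rademacher_martingale c))))%E.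
Proof.
move=> c0 d0 cp.
have m0 : (0 < m)%N.
  by rewrite lt0n; apply: contraTneq d0 => ->; rewrite /bitspan /msb big_ord0.
set F := rademacher_martingale c; set n := msb m; set l := lsb m.
have ln : (l < n)%N by move: d0; rewrite /bitspan subn_gt0.
have nld : n = (l + bitspan m)%N by rewrite /bitspan subnKC// ltnW.
(* [V] is the modulus of the error on the set [A] below. Its [p]-th power is [2 ^+ l], which cancels
   against the mass of [A]. *)
pose V := c n * (2 ^+ l / 2 ^+ n).
have Vp : V `^ p = 2 ^+ l.
  have e : 2 ^+ l / 2 ^+ n = (2^-1 : R) ^+ bitspan m.
    by rewrite nld exprD exprVn; field; rewrite !expf_neq0.
  rewrite /V e powRM ?exprn_ge0// powR_exprn// cp powR_half -mulrA -exprMn.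
  have -> : q * (loss p / 2) = 2^-1 by rewrite mulKf// gt_eqF.
  by rewrite -/n nld exprD exprVn mulfK// expf_neq0.
have V0 : 0 < V.
  apply: (@gt0_powR _ _ p); rewrite ?Vp ?exprn_gt0//.
  by rewrite mulr_ge0// divr_ge0// exprn_ge0.
(* This is [I_l(0) \ I_{l+1}(0)] written as a single cylinder: the first nonzero coordinate has rank
   [l]. *)
pose A : set walsh_group := dyadic_cylinder l.+1 (fun k => k == l).
have AP x : A x -> `|martingale_limit (sum_error m F) x| = V.
  move=> xA.
  have xl : zeros l x by move=> k kl; rewrite xA ?ltnS 1?ltnW// ltn_eqF.
  have xl1 : ~ zeros l.+1 x by move=> /(_ l (ltnSn l)); rewrite xA// eqxx.
  have xn : ~ zeros n x by move/(zeros_le ln).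
  rewrite (limit_sum_error _ m0 (ltnSn n)); last by move/(zeros_le (leqnSn n)).
  rewrite (rademacher_martingale_const c xn (leqnSn n)).
  by rewrite rademacher_partial_sum// ger0_norm.
(* The level is [V / 2] because the weak quasi-norm uses strict level sets, and the one at level [V]
   would miss [A]. *)
have mB := measurable_limit_sum_error c (V / 2) m0.
have AB : A `<=` [set x | V / 2 < `|martingale_limit (sum_error m F) x|].
  by move=> x xA; rewrite /= AP// ltr_pdivrMr// mulr_natr mulr2n ltrDl.
have V20 : 0 < V / 2 by rewrite divr_gt0.
have := weak_norm_ge p01 V20 (measurable_cylinder _ _) mB AB.
rewrite [X in (_ * X)%E]haar_cylinder -EFinM powRM ?(ltW V0) ?invr_ge0// Vp exprS.
have -> : 2 ^+ l * 2^-1 `^ p / (2 * 2 ^+ l) = 2^-1 `^ p / 2 :> R.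
  by field; rewrite expf_neq0.
move=> /(poweR_mono (r := p^-1)); rewrite invr_ge0 (ltW p0) lee_fin divr_ge0 ?powR_ge0//.
move=> /(_ isT isT); rewrite poweR_EFin -poweRrM divff ?gt_eqF// poweRe1//.
exact: poweR_ge0.
Qed.

End divergence.

Lemma limn_esup_ge (R : realType) (u : nat -> \bar R) (a : \bar R) :
  (forall k, (a <= u k)%E) -> (a <= limn_esup u)%E.
Proof.
move=> au; rewrite limn_esup_lim; apply: lime_ge; first exact: is_cvg_esups.
apply: nearW => k; apply: (le_trans (au k)).
by apply: ereal_sup_ubound; exists k => /=.
Qed.

(** * Construction of the martingale for (b) *)

Section sharpness.
Variables (R : realType) (p : R).
Hypothesis p01 : 0 < p < 1.

Let p0 : 0 < p. Proof. by case/andP: p01. Qed.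
Let loss0 : 0 < loss p. Proof. exact: lt_trans ltr01 (loss_gt1 p01). Qed.

Lemma invr_powR (x r : R) : 0 <= x -> x^-1 `^ r = (x `^ r)^-1.
Proof. by move=> x0; rewrite -powR_inv1// powRAC powR_inv1// powR_ge0. Qed.

Theorem partial_sums_diverge (m : nat -> nat) :
  ereal_sup (range (fun k => ((bitspan (m k))%:R : R)%:E)) = +oo%E ->
  exists (F : nat -> walsh_group -> R) (phi : nat -> nat),
    [/\ in_Hp p F, {homo phi : i j / (i < j)%N},
        is_big_O (fun k => omega p (msb (m (phi k))) F)
          (fun k => 1 / 2 `^ ((bitspan (m (phi k)))%:R * (1 / p - 1))) &
        ((error_bound p)%:E <= limn_esup (fun k => weak_norm p
            (martingale_limit (sum_error (m (phi k)) F))))%E].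
Proof.
move=> /sup_nat_unbounded unb.
have [phi [phi_homo d0 nd]] := @lacunary_subsequence _ (fun k => msb (m k)) unb.
pose n k := msb (m (phi k)); pose d k := bitspan (m (phi k)).
have dn k : (d k <= n k)%N by exact: leq_subr.
pose q : R := (loss p)^-1.
have q01 : 0 < q < 1 by rewrite invr_gt0 loss0 invf_lt1// loss_gt1.
have q1 : 0 < 1 - q by rewrite subr_gt0; case/andP: q01.
have q0 : 0 <= q by case/andP: q01 => /ltW.
pose e := lacunary_weight q n d.
have e0 t : 0 <= e t := lacunary_weight_ge0 n d q01 t.
(* With this choice [c t ^ p] times the mass of [zeros t] is exactly the weight [e t]. *)
pose c t : R := (2 ^+ t * e t) `^ p^-1.
have c0 t : 0 <= c t by exact: powR_ge0.
have cp t : c t `^ p = 2 ^+ t * e t.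
  by rewrite -powRrM mulVf ?gt_eqF// powRr1// mulr_ge0// exprn_ge0.
have cpe t : c t `^ p / 2 ^+ t = e t by rewrite cp mulrC mulKf// expf_neq0.
pose F := rademacher_martingale c.
have mF : is_martingale F := is_martingale_rademacher c.
exists F, phi; split=> //.
- split=> //; rewrite Hp_normE; apply: poweR_lty.
  (* Since [F 0] vanishes, finiteness of the quasi-norm is the tail bound at [n = 0]. *)
  have -> : F = tail F 0.
    apply/funext => j; apply/funext => x; rewrite (tailE mF) minn0.
    by rewrite [F 0%N x]/F /rademacher_martingale big_ord0 subr0.
  apply: le_lt_trans (ltry (q ^+ d 0%N / (1 - q))).
  apply: Hp_pow_tail_le => // N; under eq_bigr do rewrite cpe.
  exact: sum_lacunary_weight_all.
- exists ((1 - q)^-1 `^ p^-1); apply: nearW => k.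
  rewrite gee0_abs ?Lnorm_ge0// mul1r ger0_norm ?invr_ge0 ?powR_ge0//.
  have tail_le : (Hp_pow p (tail F (n k)) <= (q ^+ d k / (1 - q))%:E)%E.
    apply: Hp_pow_tail_le => // N; under eq_bigr do rewrite cpe.
    exact: sum_lacunary_weight_tail.
  rewrite /omega -/(tail _ _) Hp_normE.
  apply: (le_trans (poweR_mono _ _ tail_le)); rewrite ?invr_ge0 ?(ltW p0) ?Hp_pow_ge0//.
  rewrite poweR_EFin lee_fin powRM ?invr_ge0 ?(ltW q1) ?exprn_ge0// mulrC.
  by rewrite [q ^+ d k]exprVn (invr_powR _ (exprn_ge0 (d k) (ltW loss0))) loss_root.
- apply: limn_esup_ge => k; apply: weak_norm_sum_error_ge => //.
  rewrite cp /e -[msb _]/(n k) lacunary_weightE//.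
Qed.

End sharpness.

Theorem theorem4 (R : realType) (p : R) (hp : 0 < p < 1) :
  (forall (F : nat -> walsh_group -> R) (m : nat -> nat),
     in_Hp p F -> (forall k, (0 < m k)%N) ->
     is_little_o (fun k => omega p (msb (m k)) F)
       (fun k => 1 / 2 `^ ((bitspan (m k))%:R * (1 / p - 1))) ->
     (fun k => Hp_norm p (sum_error (m k) F)) @ \oo --> 0%E)
  /\
  (exists2 c : R, 0 < c &
     forall m : nat -> nat,
       (forall k, (0 < m k)%N) -> {homo m : i j / (i < j)%N} ->
       ereal_sup (range (fun k => ((bitspan (m k))%:R : R)%:E)) = +oo%E ->
       exists (F : nat -> walsh_group -> R) (phi : nat -> nat),
         [/\ in_Hp p F, {homo phi : i j / (i < j)%N},
             is_big_O (fun k => omega p (msb (m (phi k))) F)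
               (fun k => 1 / 2 `^ ((bitspan (m (phi k)))%:R * (1 / p - 1))) &
             (limn_esup (fun k => weak_norm p
                (martingale_limit (sum_error (m (phi k)) F))) > c%:E)%E]).
Proof.
split=> [F m|]; first exact: partial_sums_cvg_Hp.
(* Halving turns the non-strict lower bound into the strict one. *)
exists (error_bound p / 2); first by rewrite divr_gt0// error_bound_gt0.
move=> m _ _ /(partial_sums_diverge hp)[F [phi [FHp phi_homo omegaO div]]].
exists F, phi; split=> //; apply: lt_le_trans div.
by rewrite lte_fin ltr_pdivrMr// mulr_natr mulr2n ltrDl error_bound_gt0.
Qed.
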